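(* Let $(Q,\mathfrak n,k)$ be a regular local ring with $k$ algebraically closed, let $I\subseteq\mathfrak n^2$ be an ideal generated by a $Q$-regular sequence of length $c$, and put $R=Q/I$ and $V=I/\mathfrak nI$. Let $R'=Q/J$ and $R''=Q/J'$ be complete intersections intermediate to $Q$ and $R$ that are equivalent, that is, $\varphi_J(J/\mathfrak nJ)=\varphi_{J'}(J'/\mathfrak nJ')$ in $V$. Then for all finitely generated $R$-modules $M$ and $N$ we have $$\varphi_J\big(V_{R'}(M,N)\big)=\varphi_{J'}\big(V_{R''}(M,N)\big).$$
   Context: A complete intersection intermediate to $Q$ and $R$ is a ring $Q/J$, where $J\subseteq I$ is the ideal generated by preimages in $I$ of a basis of some $k$-subspace $W$ of $V$ (such preimages form a $Q$-regular sequence). For such $J$, the map $\varphi_J\colon J/\mathfrak nJ\to V$ is $f+\mathfrak nJ\mapsto f+\mathfrak nI$; it is injective with image $W$. For $(Q,\mathfrak n,k)$ regular local and an ideal $I\subseteq\mathfrak n^2$ generated by a regular sequence, with $R=Q/I$, $V=I/\mathfrak nI$, and $\overline f$ denoting the image in $V$ of $f\in I$, the support variety of a pair of finitely generated $R$-modules $(M,N)$ is the subset of $V$ $$V_R(M,N)=\{\overline f\in V\mid \operatorname{Ext}^i_{Q/(f)}(M,N)\neq 0\text{ for infinitely many } i\}\cup\{0\}.$$ For $\overline f\neq0$ the condition depends only on $\overline f$ and not on the choice of representative $f$. The varieties $V_{R'}(M,N)\subseteq J/\mathfrak nJ$ and $V_{R''}(M,N)\subseteq J'/\mathfrak nJ'$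 are defined the same way, with $I$ replaced by $J$, respectively $J'$; here $R$-modules are regarded as $R'$- and $R''$-modules via the natural surjections onto $R$. *)

(* Defs.v *)
From HB Require Import structures.
From mathcomp Require Import all_boot all_order all_algebra.
From mathcomp Require Import boolp classical_sets cardinality.

Set Implicit Arguments.
Unset Strict Implicit.
Unset Printing Implicit Defensive.

Import GRing.Theory.

Local Open Scope ring_scope.
Local Open Scope quotient_scope.

(* Only proper ideals are bundled, as MathComp's [idealr Q]: the quotient [Q / I]
   is then the nonzero ring [{ideal_quot I}].                                *)

Section Span.
Variables (A : comNzRingType) (M : lmodType A).

(* The submodule generated by a finite sequence; an ideal when [M] is [A^o]. *)
Definition submod_span (s : seq M) : {pred M} := fun x =>
  `[< exists a : 'I_(size s) -> A, x = \sum_(i < size s) a i *: s`_i >].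

Definition fin_gen : Prop := exists s : seq M, forall x : M, x \in submod_span s.

(* [prodS a S] is the set [a S] of finite sums of products [r *: m] with
   [r \in a] and [m \in S].                                                  *)
Definition prodS (a : {pred A}) (S : {pred M}) : {pred M} := fun x =>
  `[< exists r : seq (A * M),
        all (fun p => (p.1 \in a) && (p.2 \in S)) r
        /\ x = \sum_(p <- r) p.1 *: p.2 >].

Definition lin_indep (s : seq M) : Prop :=
  forall a : 'I_(size s) -> A,
    \sum_(i < size s) a i *: s`_i = 0 -> forall i, a i = 0.

Definition is_basis (W : {pred M}) (s : seq M) : Prop :=
  lin_indep s /\ W =i submod_span s.

Lemma submod_span_closed (s : seq M) : GRing.submod_closed (submod_span s).
Proof.
split.
  apply/asboolP; exists (fun=> 0); rewrite big1 // => i _; exact: scale0r.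
move=> c u v /asboolP[a ->] /asboolP[b ->]; apply/asboolP.
exists (fun i => c * a i + b i); rewrite scaler_sumr -big_split /=.
by apply: eq_bigr => i _; rewrite scalerDl scalerA.
Qed.

End Span.

Section RegularLocal.
Variable Q : comNzRingType.

(* The unit ideal, which is not an [idealr], is generated by 1. *)
Definition noetherian : Prop :=
  forall a : idealr Q, exists s : seq Q^o, a =i submod_span s.

Definition maximal_ideal (m : idealr Q) : Prop :=
  forall a : idealr Q, {subset m <= a} -> a =i m.

Definition local_ring (n : idealr Q) : Prop :=
  maximal_ideal n /\ forall m : idealr Q, maximal_ideal m -> m =i n.

Definition prime_chain (d : nat) (p : nat -> prime_idealr Q) : Prop :=
  forall i, (i < d)%N ->
    {subset p i <= p i.+1} /\ ~ {subset p i.+1 <= p i}.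

Definition krull_dim_eq (d : nat) : Prop :=
  (exists p, prime_chain d p) /\
  (forall e p, prime_chain e p -> (e <= d)%N).

Definition regular_local_ring (n : idealr Q) : Prop :=
  [/\ noetherian, local_ring n
    & exists s : seq Q^o, n =i submod_span s /\ krull_dim_eq (size s)].

Definition regular_sequence (s : seq Q^o) : Prop :=
  1 \notin submod_span s /\
  forall i, (i < size s)%N ->
    forall x : Q, x * s`_i \in submod_span (take i s) -> x \in submod_span (take i s).

End RegularLocal.

Section IdealModule.
Variables (Q : comNzRingType) (I : idealr Q).

Definition ideal_pred : pred Q^o := fun x => x \in (I : {pred Q}).

Fact ideal_pred_submod : GRing.submod_closed ideal_pred.
Proof.
split=> [|a u v uI vI]; first exact: (idealr0 I).
by apply: (@rpredD Q I); first exact: (idealMr a uI).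
Qed.

HB.instance Definition _ :=
  GRing.isSubmodClosed.Build Q Q^o ideal_pred
    (GRing.submod_closed_semi ideal_pred_submod).

Record ideal_mod := IdealMod { ideal_val : Q^o; _ : ideal_pred ideal_val }.

HB.instance Definition _ := [isSub for ideal_val].
HB.instance Definition _ := [Choice of ideal_mod by <:].
HB.instance Definition _ := [SubChoice_isSubLmodule of ideal_mod by <:].

Lemma ideal_modP (f : ideal_mod) : (ideal_val f : Q) \in (I : {pred Q}).
Proof. by case: f. Qed.

End IdealModule.

Section QuotProj.
Variables (Q : comNzRingType) (a : idealr Q).

Definition qpi (x : Q) : {ideal_quot a} := \pi x.

Lemma qpi_eq x y : (qpi x = qpi y) <-> (x - y \in a).
Proof.
rewrite Quotient.idealrBE; split=> [h|/eqP h]; last exact: h.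
by apply/eqP; exact: h.
Qed.

Lemma qpi_repr (c : {ideal_quot a}) : qpi (repr c) = c.
Proof. exact: reprK. Qed.

Fact qpi_zmod : zmod_morphism qpi.
Proof. exact: pi_is_zmod_morphism. Qed.

Fact qpi_monoid : monoid_morphism qpi.
Proof. exact: pi_is_monoid_morphism. Qed.

HB.instance Definition _ := GRing.isZmodMorphism.Build _ _ qpi qpi_zmod.
HB.instance Definition _ := GRing.isMonoidMorphism.Build _ _ qpi qpi_monoid.

End QuotProj.

(* [reduction a M] is [M / a M], as a module over [Q / a]; for the maximal ideal
   [n] and [M] an ideal [I] it is the [k]-vector space [I / n I].            *)
Section Reduction.
Variables (Q : comNzRingType) (a : idealr Q) (M : lmodType Q).

Definition aM : {pred M} := prodS (a : {pred Q}) predT.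

Fact aM_submod : GRing.submod_closed aM.
Proof.
split; first by apply/asboolP; exists [::]; rewrite big_nil.
move=> c u v /asboolP[r [rP ->]] /asboolP[t [tP ->]]; apply/asboolP.
exists ([seq (c * p.1, p.2) | p <- r] ++ t); split.
  rewrite all_cat tP andbT all_map; apply: sub_all rP => p /= /andP[pa ->].
  by rewrite andbT; exact: idealMr.
rewrite big_cat big_map scaler_sumr /=; congr (_ + _).
by apply: eq_bigr => p _; rewrite scalerA.
Qed.

HB.instance Definition _ :=
  GRing.isSubmodClosed.Build Q M aM (GRing.submod_closed_semi aM_submod).

Definition reduction : Type := Quotient.quot aM.

HB.instance Definition _ := Choice.on reduction.
HB.instance Definition _ := GRing.Zmodule.on reduction.
HB.instance Definition _ := EqQuotient.on reduction.

Definition red (x : M) : reduction := \pi_(Quotient.quot aM) x.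

Lemma redE (x y : M) : (red x = red y) <-> (x - y \in aM).
Proof.
rewrite /red; split=> [/eqP|h]; first by rewrite -Quotient.idealrBE.
by apply/eqP; rewrite -Quotient.idealrBE.
Qed.

Lemma red_repr (v : reduction) : red (repr v) = v.
Proof. exact: (@reprK _ (Quotient.quot aM) v). Qed.

Lemma redD (x y : M) : red (x + y) = red x + red y.
Proof. exact: (raddfD (\pi_(Quotient.quot aM) : {additive M -> Quotient.quot aM})). Qed.

Definition red_scale (c : {ideal_quot a}) (v : reduction) : reduction :=
  red (repr c *: repr v).

Lemma red_scaleE (c : Q) (x : M) : red_scale (qpi a c) (red x) = red (c *: x).
Proof.
apply/redE; set c' := repr _; set x' := repr _.
have c'P : c' - c \in a by apply/qpi_eq; rewrite qpi_repr.
have x'P : x' - x \in aM by apply/redE; rewrite red_repr.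
have -> : c' *: x' - c *: x = c' *: (x' - x) + (c' - c) *: x.
  by rewrite scalerBr scalerBl addrA subrK.
apply: (@rpredD M aM); first exact: (@rpredZ Q M aM).
by apply/asboolP; exists [:: (c' - c, x)]; rewrite /= c'P big_seq1.
Qed.

Fact red_scaleA c d v : red_scale c (red_scale d v) = red_scale (c * d) v.
Proof.
rewrite -[c]qpi_repr -[d]qpi_repr -[v]red_repr.
by rewrite -rmorphM !red_scaleE scalerA.
Qed.

Fact red_scale1 : left_id 1 red_scale.
Proof.
by move=> v; rewrite -[v]red_repr -(rmorph1 (qpi a)) red_scaleE scale1r.
Qed.

Fact red_scaleDr : right_distributive red_scale +%R.
Proof.
move=> c u v; rewrite -[c]qpi_repr -[u]red_repr -[v]red_repr.
by rewrite -redD !red_scaleE scalerDr redD.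
Qed.

Fact red_scaleDl v : {morph red_scale^~ v : c d / c + d}.
Proof.
move=> c d /=; rewrite -[c]qpi_repr -[d]qpi_repr -[v]red_repr.
by rewrite -rmorphD !red_scaleE scalerDl redD.
Qed.

HB.instance Definition _ :=
  GRing.Zmodule_isLmodule.Build {ideal_quot a} reduction
    red_scaleA red_scale1 red_scaleDr red_scaleDl.

End Reduction.

Definition ideal_fiber (Q : comNzRingType) (n I : idealr Q) :=
  reduction n (ideal_mod I).

Section Phi.
Variables (Q : comNzRingType) (n I J : idealr Q) (sJI : {subset J <= I}).

Definition ideal_incl (f : ideal_mod J) : ideal_mod I :=
  IdealMod (sJI (ideal_modP f)).

(* On cosets: [f + n J |-> f + n I], see [phiE]. *)
Definition phi (v : ideal_fiber n J) : ideal_fiber n I :=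
  red n (ideal_incl (repr v)).

Lemma phiE (f : ideal_mod J) : phi (red n f) = red n (ideal_incl f).
Proof.
apply/redE; have /redE := red_repr (red n f).
case/asboolP => r [rP rE]; apply/asboolP.
exists [seq (p.1, ideal_incl p.2) | p <- r]; split.
  rewrite all_map; apply: sub_all rP => p /= /andP[pn _]; exact/andP.
rewrite big_map; apply: val_inj.
rewrite raddfB raddf_sum /=.
have := congr1 val rE; rewrite raddfB raddf_sum /= => ->.
by apply: eq_bigr => p _.
Qed.

End Phi.

Arguments phi {Q} n {I J} sJI v.

Section QuotMap.
Variables (Q : comNzRingType) (a b : idealr Q) (sab : {subset a <= b}).

(* The natural surjection [Q / a -> Q / b] for [a] contained in [b]; the
   unused argument lets HB attach the morphism structure.                    *)
Definition quot_map of {subset a <= b} := fun x : {ideal_quot a} =>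
  qpi b (repr x).
Local Notation h := (quot_map sab).

Lemma quot_mapE (x : Q) : h (qpi a x) = qpi b x.
Proof. by apply/qpi_eq/sab/qpi_eq; rewrite qpi_repr. Qed.

Fact quot_map_zmod : zmod_morphism h.
Proof.
move=> x y; rewrite -[x]qpi_repr -[y]qpi_repr.
by rewrite -rmorphB !quot_mapE rmorphB.
Qed.

Fact quot_map_monoid : monoid_morphism h.
Proof.
split; first by rewrite -(rmorph1 (qpi a)) quot_mapE rmorph1.
move=> x y; rewrite -[x]qpi_repr -[y]qpi_repr.
by rewrite -rmorphM !quot_mapE rmorphM.
Qed.

HB.instance Definition _ := GRing.isZmodMorphism.Build _ _ h quot_map_zmod.
HB.instance Definition _ := GRing.isMonoidMorphism.Build _ _ h quot_map_monoid.

End QuotMap.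

Section Restrict.
Variables (A B : comNzRingType) (h : {rmorphism A -> B}) (M : lmodType B).

Definition restrict_scalars of {rmorphism A -> B} : Type := M.
Local Notation hM := (restrict_scalars h).

HB.instance Definition _ := GRing.Zmodule.on hM.

Definition restrict_scale (c : A) (x : hM) : hM := h c *: (x : M).

Fact restrict_scaleA c d x :
  restrict_scale c (restrict_scale d x) = restrict_scale (c * d) x.
Proof. by rewrite /restrict_scale scalerA rmorphM. Qed.

Fact restrict_scale1 : left_id 1 restrict_scale.
Proof. by move=> x; rewrite /restrict_scale rmorph1 scale1r. Qed.

Fact restrict_scaleDr : right_distributive restrict_scale +%R.
Proof. by move=> c x y; rewrite /restrict_scale scalerDr. Qed.

Fact restrict_scaleDl x : {morph restrict_scale^~ x : c d / c + d}.
Proof. by move=> c d; rewrite /restrict_scale rmorphD scalerDl. Qed.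

HB.instance Definition _ :=
  GRing.Zmodule_isLmodule.Build A hM
    restrict_scaleA restrict_scale1 restrict_scaleDr restrict_scaleDl.

End Restrict.

Section Ext.
Variable A : comNzRingType.

Definition projective (P : lmodType A) : Prop :=
  forall (X Y : lmodType A) (g : {linear X -> Y}) (u : {linear P -> Y}),
    (forall y, exists x, g x = y) ->
    exists w : {linear P -> X}, forall p, g (w p) = u p.

Record proj_resolution (M : lmodType A) := ProjResolution {
  res_mod : nat -> lmodType A;
  res_diff : forall n, {linear res_mod n.+1 -> res_mod n};
  res_aug : {linear res_mod 0%N -> M};
  res_projective : forall n, projective (res_mod n);
  res_aug_surj : forall y, exists x, res_aug x = y;
  res_exact0 : forall x, res_aug x = 0 <-> exists y, res_diff 0%N y = x;
  res_exactS : forall n x, res_diff n x = 0 <-> exists y, res_diff n.+1 y = x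
}.

Section Cohomology.
Variables (M N : lmodType A) (P : proj_resolution M).

Definition Hom_cocycle (i : nat) (g : {linear res_mod P i -> N}) : Prop :=
  forall x, g (res_diff P i x) = 0.

Definition Hom_coboundary (i : nat) : {linear res_mod P i -> N} -> Prop :=
  match i with
  | 0%N => fun g => forall x, g x = 0
  | j.+1 => fun g => exists u : {linear res_mod P j -> N},
                       forall x, g x = u (res_diff P j x)
  end.

End Cohomology.

(* [Ext^i_A(M, N)] is the [i]-th cohomology of [Hom_A(P, N)] for a projective
   resolution [P] of [M]; it does not depend on [P] up to isomorphism, so it is
   nonzero as soon as it is so for one [P].                                  *)
Definition Ext_neq0 (M N : lmodType A) (i : nat) : Prop :=
  exists (P : proj_resolution M) (g : {linear res_mod P i -> N}),
    Hom_cocycle g /\ ~ Hom_coboundary g.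

End Ext.

Section SupportVariety.
Variables (Q : comNzRingType) (n J : idealr Q).

Section Principal.
Variable f : ideal_mod J.

Definition princ : {pred Q} := submod_span [:: ideal_val f].

Lemma princ_sub : {subset princ <= J}.
Proof.
move=> x /asboolP[a ->]; rewrite big_ord1 /=.
exact: (idealMr _ (ideal_modP f)).
Qed.

Fact princ_idealr : idealr_closed princ.
Proof.
have [h0 hS] := submod_span_closed [:: ideal_val f].
split=> //.
by apply/negP => /princ_sub; rewrite idealr1.
Qed.

HB.instance Definition _ := isIdealr.Build Q princ princ_idealr.

End Principal.

(* The modules over [Q / J] are seen over [Q / (f)] via [Q / (f) -> Q / J].
   The class of [f] is in the variety as soon as one representative qualifies;
   the condition does not depend on it when the class is nonzero.            *)
Definition support_variety (M N : lmodType {ideal_quot J}) :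
    set (ideal_fiber n J) :=
  [set v | v = 0 \/
    exists f : ideal_mod J, v = red n f /\
      infinite_set [set i : nat |
        Ext_neq0 (restrict_scalars M (quot_map (@princ_sub f)))
                 (restrict_scalars N (quot_map (@princ_sub f))) i]]%classic.

End SupportVariety.

Arguments support_variety {Q} n {J} M N.

(* [J] is generated by preimages in [I] of a basis of a [k]-subspace of
   [I / n I], where [k = Q / n].                                             *)
Definition intermediate (Q : comNzRingType) (n I J : idealr Q) : Prop :=
  exists (W : submodClosed (ideal_fiber n I)) (s : seq (ideal_mod I)),
    is_basis W [seq red n f | f <- s] /\
    J =i submod_span [seq ideal_val f | f <- s].

(* Main.v *)
From HB Require Import structures.
Require Import Defs.
From mathcomp Require Import all_boot all_order all_algebra.
From mathcomp Require Import boolp classical_sets cardinality.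

Set Implicit Arguments.
Unset Strict Implicit.
Unset Printing Implicit Defensive.

Import GRing.Theory.

Local Open Scope ring_scope.

(** A point of either variety comes from an element [f] of [J] or [g] of [J'], and
    equality of their images in [I / n I] means that [f - g] lies in [n I]. Since the
    two images of [J / n J] and [J' / n J'] agree, the theorem amounts to this: if
    [f] and [g] in [I], outside [n I], differ by an element of [n I], then
    [Ext_{Q/(g)}(M, N)] vanishes in all high degrees as soon as
    [Ext_{Q/(f)}(M, N)] does. Adding the terms of [f - g] one by one, one may take
    [g = f + x y] with [x] in [n] and [y] in [I].

    The two rings are members of the family [Q[t]/(F)], with [F = f + y t], at the
    parameters [t = 0] and [t = x]. The coefficients of [F] lie in [I] and so kill
    [M] and [N], which makes [M[t]] and [N[t]] modules over [Q[t]/(F)]. If [F(c)] is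
    a regular element, then [t - c] is regular on [Q[t]/(F)], so that a free
    resolution of [M[t]] over [Q[t]/(F)] reduces modulo [t - c] to one of [M] over
    [Q/(F(c))] ([ev_rel_rowsP]). The exact sequence of [t - c] on [N[t]] then
    compares the modules [E^i = Ext^i_{Q[t]/(F)}(M[t], N[t])] with
    [Ext^i_{Q/(F(c))}(M, N)]. If the latter is zero for [c = 0], then
    [E^i = t E^i]; as [E^i] is finitely generated over the noetherian ring [Q[t]]
    ([hilbert_basis]), it is killed by a polynomial [p] with [p(0) = 1]. Then [p(x)]
    is a unit because [x] is in [n] and [Q] is local, so [t - x] is bijective on
    [E^i]. When this holds for [E^i] and [E^(i+1)], the exact sequence gives the
    vanishing of [Ext^i_{Q/(F(x))}(M, N)] ([vanishing_specialization],
    [Ext_bounded_family]).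

    It remains that elements of [I] outside [n I] are regular: such an element is a
    combination of the given regular sequence with a unit coefficient, and regular
    sequences in a noetherian local ring can be permuted
    ([minimal_generator_regular]).

    Everything is done with matrices. [M] and [N] are quotients of [Q^m] and [Q^l]
    by submodules [L] and [K], the same ones for all the rings over which [M] and [N]
    are considered; [M[t]] is the quotient of [Q[t]^m] by [poly_rows L], and
    homomorphisms from a free module to [N[t]] are matrices over [Q[t]] modulo those
    with rows in [poly_rows K]. Comparison of projective resolutions
    ([cohomology_vanishing_transfer]) translates the vanishing of [Ext] into a
    statement on matrices ([Ext_vanishingP]). *)

(** * Finitely generated submodules of free modules *)

Section FinitelyGenerated.
Variable A : comNzRingType.

(** Submodules of free modules are predicates on row vectors, so that no quotient or
    subtype has to be formed; they are finitely generated if they are row spaces. *)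
Definition submodule_pred (m : nat) (P : 'rV[A]_m -> Prop) : Prop :=
  P 0 /\ forall a u v, P u -> P v -> P (a *: u + v).

Definition row_generated (m : nat) (P : 'rV[A]_m -> Prop) : Prop :=
  exists r (D : 'M[A]_(r, m)), forall x, P x <-> exists y, x = y *m D.

Lemma submoduleD m (P : 'rV[A]_m -> Prop) u v :
  submodule_pred P -> P u -> P v -> P (u + v).
Proof. by case=> _ h Pu Pv; rewrite -[u]scale1r; apply: h. Qed.

Lemma submoduleZ m (P : 'rV[A]_m -> Prop) a u :
  submodule_pred P -> P u -> P (a *: u).
Proof. by case=> h0 h Pu; rewrite -[_ *: _]addr0; apply: h. Qed.

Lemma submoduleB m (P : 'rV[A]_m -> Prop) u v :
  submodule_pred P -> P u -> P v -> P (u - v).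
Proof.
by move=> h Pu Pv; apply: submoduleD => //; rewrite -scaleN1r; apply: submoduleZ.
Qed.

Lemma submodule_sum m (P : 'rV[A]_m -> Prop) (J : Type) (r : seq J) (C : pred J)
    (F : J -> 'rV[A]_m) :
  submodule_pred P -> (forall i, C i -> P (F i)) -> P (\sum_(i <- r | C i) F i).
Proof.
move=> h PF; elim/big_ind: _ => //; first exact: h.1.
by move=> u v; apply: submoduleD.
Qed.

Lemma submodule_mulmx m (P : 'rV[A]_m -> Prop) r (D : 'M[A]_(r, m)) y :
  submodule_pred P -> (forall i, P (row i D)) -> P (y *m D).
Proof.
move=> h PD; rewrite mulmx_sum_row; apply: submodule_sum => // i _.
exact: submoduleZ.
Qed.

Definition noetherian_rows (m : nat) : Prop :=
  forall P : 'rV[A]_m -> Prop, submodule_pred P -> row_generated P.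

Local Lemma mulmx0r p q r (y : 'M[A]_(p, q)) : y *m (0 : 'M[A]_(q, r)) = 0.
Proof. exact: mulmx0. Qed.

(** Induction on the rank: a submodule of a direct sum is an extension of its
    first projection by its intersection with the second summand. *)
Lemma noetherian_rowsW : noetherian_rows 1 -> forall m, noetherian_rows m.
Proof.
move=> h1; elim=> [|m IH] P hP.
  exists 0, 0 => x; split=> [_|[y ->]]; first by exists 0; apply/rowP => -[].
  by rewrite mulmx0; case: hP.
rewrite -[m.+1]/(1 + m)%N in P hP *.
have [|r1 [D1 D1P]] := h1 (fun c => exists y, P (row_mx c y)).
  split; first by exists 0; rewrite row_mx0; exact: hP.1.
  move=> a u v [u' Pu] [v' Pv]; exists (a *: u' + v').
  by rewrite -add_row_mx -scale_row_mx; apply: hP.2.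
have [|r2 [D2 D2P]] := IH (fun y => P (row_mx 0 y)).
  split; first by rewrite row_mx0; exact: hP.1.
  move=> a u v Pu Pv; suff -> : row_mx 0 (a *: u + v) =
    a *: row_mx 0 u + row_mx 0 v :> 'rV_(1 + m) by apply: hP.2.
  by rewrite scale_row_mx add_row_mx scaler0 addr0.
have /choice[w wP] i : exists y, P (row_mx (row i D1) y).
  by apply/D1P; exists (delta_mx 0 i); rewrite rowE.
pose E := \matrix_i w i; pose D' := row_mx D1 E.
have PE y : P (y *m D').
  apply: submodule_mulmx => // i; have := wP i; congr P.
  by rewrite row_row_mx rowK.
exists (r1 + r2)%N, (col_mx D' (row_mx 0 D2)) => x; split=> [Px|[y ->]].
  have [y1 y1P] : exists y, lsubmx x = y *m D1.
    by apply/D1P; exists (rsubmx x); rewrite hsubmxK.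
  have [y2 y2P] : exists y, rsubmx x - y1 *m E = y *m D2.
    apply/D2P; have := submoduleB hP Px (PE y1).
    by rewrite -{1}[x]hsubmxK mul_mx_row opp_row_mx add_row_mx y1P subrr.
  exists (row_mx y1 y2); rewrite mul_row_col /D' !mul_mx_row mulmx0r add_row_mx addr0.
  by rewrite -y1P -y2P addrC subrK hsubmxK.
rewrite -[y]hsubmxK mul_row_col (mul_mx_row (rsubmx y)) mulmx0r.
by apply: submoduleD => //; apply/D2P; exists (rsubmx y).
Qed.

End FinitelyGenerated.

Section Hilbert.
Variable A : comNzRingType.
Hypothesis noethA : forall m, noetherian_rows A m.

(** The leading coefficients of the ideal form an ideal of [A], generated by those of
    finitely many members [g i] that may be taken of the same degree [d]. These reduce
    any member to one of degree below [d], and the latter are finitely generated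
    as a submodule of [A^d]. *)
Lemma hilbert_basis : noetherian_rows {poly A} 1.
Proof.
move=> P hP; pose PP (p : {poly A}) := P p%:M.
have PP0 : PP 0 by rewrite /PP raddf0; exact: hP.1.
have PPD p q : PP p -> PP q -> PP (p + q).
  by rewrite /PP raddfD; apply: submoduleD.
have PPM p q : PP q -> PP (p * q).
  by rewrite /PP -scale_scalar_mx; apply: submoduleZ.
have PPZ (a : A) q : PP q -> PP (a *: q) by rewrite -mul_polyC; apply: PPM.
(* the degree [d] need not be that of [p]: thus [0] is a leading coefficient *)
pose lc (c : 'rV[A]_1) := exists d p,
  [/\ PP p, (size p <= d.+1)%N & p`_d = c 0 0].
have lcW c d p e : PP p -> (size p <= d.+1)%N -> p`_d = c -> (d <= e)%N ->
    exists q, [/\ PP q, (size q <= e.+1)%N & q`_e = c].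
  move=> Pp sp pd le; exists ('X^(e - d) * p); split; first exact: PPM.
    rewrite mulrC (leq_trans (size_polyMleq _ _)) // size_polyXn addnS /=.
    by rewrite -{2}(subnKC le) -addSn leq_add2r.
  by rewrite coefXnM ltnNge leq_subr /= subKn.
have [|r [D DP]] := noethA (P := lc).
  split; first by exists 0%N, 0; rewrite size_poly0 coef0 mxE.
  move=> a u v [d [p [Pp sp pd]]] [e [q [Pq sq qe]]].
  have [p' [Pp' sp' pd']] := lcW _ _ _ (d + e)%N Pp sp pd (leq_addr _ _).
  have [q' [Pq' sq' qe']] := lcW _ _ _ (d + e)%N Pq sq qe (leq_addl _ _).
  exists (d + e)%N, (a *: p' + q'); split.
  - by apply: PPD => //; apply: PPZ.
  - rewrite (leq_trans (size_polyD _ _)) // geq_max sq' andbT.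
    by rewrite (leq_trans (size_scale_leq _ _)).
  - by rewrite coefD coefZ pd' qe' !mxE.
have /choice[dp dpP] i : exists dp : nat * {poly A},
    [/\ PP dp.2, (size dp.2 <= dp.1.+1)%N & dp.2`_dp.1 = D i 0].
  have [d [p]] : lc (row i D).
    by apply/DP; exists (delta_mx 0 i); rewrite rowE.
  by rewrite mxE => h; exists (d, p).
pose d := (\max_i (dp i).1)%N.
have /choice[g gP] i : exists q, [/\ PP q, (size q <= d.+1)%N & q`_d = D i 0].
  by have [h1 h2 h3] := dpP i; apply: lcW h1 h2 h3 (leq_bigmax i).
have [|r2 [D2 D2P]] := noethA (P := fun v : 'rV[A]_d => PP (rVpoly v)).
  split; first by rewrite raddf0.
  move=> a u v Pu Pv; rewrite linearD linearZ /=.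
  by apply: PPD => //; apply: PPZ.
pose G := col_mx (\col_i g i) (\col_i rVpoly (row i D2)).
exists (r + r2)%N, G => x; split; last first.
  move=> [y ->]; apply: submodule_mulmx => // i.
  rewrite (_ : row i G = (G i 0)%:M); last first.
    by apply/rowP => j; rewrite !ord1 !mxE eqxx mulr1n.
  rewrite -[P _]/(PP _) mxE; case: split_ordP => k _; rewrite mxE.
    by case: (gP k).
  by apply/D2P; exists (delta_mx 0 k); rewrite rowE.
suff H N (p : {poly A}) : (size p <= N)%N -> PP p -> exists y, p%:M = y *m G.
  move=> Px; have xE : x = (x 0 0)%:M by rewrite [LHS]mx11_scalar.
  by rewrite xE; apply: (H (size (x 0 0))) => //; rewrite /PP -xE.
have GD y z u v : u = y *m G -> v = z *m G -> exists w, u + v = w *m G.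
  by move=> -> ->; exists (y + z); rewrite mulmxDl.
elim: N p => [|N IH] p sp Pp.
  exists 0; rewrite mul0mx; move: sp; rewrite leqn0 size_poly_eq0 => /eqP ->.
  by rewrite raddf0.
have [sN|Ns] := leqP (size p) d.
  have [y yP] : exists y, poly_rV p = y *m D2.
    by apply/D2P; rewrite poly_rV_K.
  exists (row_mx 0 (map_mx polyC y)); rewrite mul_row_col mul0mx add0r.
  apply/rowP => j; rewrite !ord1 !mxE eqxx mulr1n -[p](poly_rV_K sN) yP.
  rewrite mulmx_sum_row linear_sum /=; apply: eq_bigr => k _.
  by rewrite !mxE linearZ /= mul_polyC.
have dN : (d <= N)%N by rewrite -ltnS (leq_trans Ns).
have [c cP] : exists c, (p`_N)%:M = c *m D.
  by apply/DP; exists N, p; rewrite mxE eqxx mulr1n.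
pose q := \sum_i (c 0 i *: 'X^(N - d)) * g i.
have qG : q%:M = row_mx (\row_i (c 0 i *: 'X^(N - d))) 0 *m G.
  rewrite mul_row_col mul0mx addr0; apply/rowP => j; rewrite !ord1 !mxE eqxx mulr1n.
  by apply: eq_bigr => k _; rewrite !mxE.
have Pq : PP q.
  rewrite /q; elim/big_ind: _ => // k _; apply: PPM.
  by case: (gP k).
have sq : (size q <= N.+1)%N.
  rewrite (leq_trans (size_sum _ _ _)) //; apply/bigmax_leqP => k _.
  rewrite -scalerAl (leq_trans (size_scale_leq _ _)) //.
  rewrite (leq_trans (size_polyMleq _ _)) // size_polyXn addSn /=.
  by have [_ h _] := gP k; rewrite (leq_trans (leq_add (leqnn _) h)) // addnS subnK.
have qN : q`_N = p`_N.
  transitivity ((c *m D) 0 0); last by rewrite -cP mxE eqxx mulr1n.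
  rewrite mxE coef_sum; apply: eq_bigr => k _.
  rewrite -scalerAl coefZ coefXnM ltnNge leq_subr /= subKn //.
  by case: (gP k) => _ _ ->.
have [||y yP] := IH (p - q).
- apply/leq_sizeP => j; rewrite leq_eqVlt => /predU1P[<-|Nj].
    by rewrite coefB qN subrr.
  by rewrite coefB !nth_default ?subrr // ?(leq_trans sq) // (leq_trans sp).
- by apply: PPD => //; rewrite -scaleN1r; apply: PPZ.
by have := GD _ _ _ _ _ yP qG; rewrite -raddfD subrK.
Qed.

End Hilbert.

(** * Noetherian local rings *)

Section Local.
Variable Q : comNzRingType.

Definition ideal_prop (P : Q -> Prop) : Prop :=
  P 0 /\ forall a u v, P u -> P v -> P (a * u + v).

Lemma ideal_of_prop (P : Q -> Prop) :
  ideal_prop P -> ~ P 1 -> exists a : idealr Q, forall x, (x \in a) = `[< P x >].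
Proof.
move=> [P0 PD] P1; pose p : {pred Q} := fun x => `[< P x >].
have hp : idealr_closed p.
  split; [exact/asboolP | exact/asboolP|].
  by move=> a u v /asboolP Pu /asboolP Pv; apply/asboolP/PD.
pose a : idealr Q := HB.pack p (isIdealr.Build Q p hp).
by exists a.
Qed.

Lemma mem_ideal_prop (a : idealr Q) : ideal_prop (fun x => x \in a).
Proof.
split=> [|c u v ua va]; first exact: rpred0.
by apply: rpredD => //; apply: idealMr.
Qed.

Lemma noetherian_rows1 : noetherian Q -> noetherian_rows Q 1.
Proof.
move=> hQ P hP; have [P1|P1] := pselect (P 1%:M).
  exists 1%N, 1%:M => x; split=> [_|[y ->]]; first by exists x; rewrite mulmx1.
  apply: submodule_mulmx => // i; rewrite (_ : row i _ = 1%:M) //.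
  by apply/rowP => j; rewrite !ord1 !mxE.
have [|a aP] := @ideal_of_prop (fun c => P c%:M) _ P1.
  split; first by rewrite raddf0; exact: hP.1.
  by move=> a u v Pu Pv; rewrite raddfD /= -scale_scalar_mx; apply: hP.2.
have [g gP] := hQ a.
exists (size g), (\col_i g`_i) => x; rewrite [x]mx11_scalar.
have -> : P (x 0 0)%:M <-> x 0 0 \in a by rewrite aP; split=> [/asboolP|/asboolP].
rewrite gP; split=> [/asboolP[y yP]|[y yP]].
  exists (\row_i y i); apply/rowP => j; rewrite !ord1 !mxE eqxx mulr1n yP.
  by apply: eq_bigr => i _; rewrite !mxE.
apply/asboolP; exists (y 0); have /rowP/(_ 0) := yP.
rewrite !mxE eqxx mulr1n => ->.
by apply: eq_bigr => i _; rewrite !mxE.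
Qed.

(** Zorn's lemma, on the proper ideals containing [a]. *)
Lemma maximal_above (a : idealr Q) :
  exists m : idealr Q, maximal_ideal m /\ {subset a <= m}.
Proof.
pose T := {b : idealr Q | {subset a <= b}}.
have aa : {subset a <= a} by [].
pose R (x y : T) := `[< {subset sval x <= sval y} >].
have [||C totC|m mmax] := @ZL_preorder T (exist _ a aa) R.
- by move=> x; apply/asboolP.
- by move=> x y z /asboolP xy /asboolP yz; apply/asboolP => u /xy/yz.
- have [[b0 Cb0]|C0] := pselect (exists b, C b); last first.
    by exists (exist _ a aa) => b Cb; case: C0; exists b.
  have [|[b [_]]|m mP] := @ideal_of_prop (fun x => exists b, C b /\ x \in sval b).
  + split=> [|c u v [b1 [C1 u1]] [b2 [C2 v2]]].
      by exists b0; split=> //; exact: rpred0.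
    have [/asboolP h|/asboolP h] := totC _ _ C1 C2.
      by exists b2; split=> //; apply: ((mem_ideal_prop (sval b2)).2) => //; exact: h.
    by exists b1; split=> //; apply: ((mem_ideal_prop (sval b1)).2) => //; exact: h.
  + by rewrite idealr1.
  have am : {subset a <= m}.
    by move=> x ax; rewrite mP; apply/asboolP; exists b0; split=> //; exact: (svalP b0).
  exists (exist _ m am) => b Cb; apply/asboolP => x bx /=.
  by rewrite mP; apply/asboolP; exists b.
exists (sval m); split; last exact: (svalP m).
move=> b mb; have ab : {subset a <= b} by move=> x /(svalP m)/mb.
have /asboolP bm : R (exist _ b ab) m by apply: mmax; apply/asboolP.
by move=> x; apply/idP/idP => [/bm|/mb].
Qed.

Variable n : idealr Q.
Hypothesis hn : local_ring n.

Lemma local_ideal_sub (a : idealr Q) : {subset a <= n}.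
Proof. by have [m [/hn.2 mn am]] := maximal_above a; move=> x /am; rewrite mn. Qed.

Lemma local_unit u : u \notin n -> exists v, v * u = 1.
Proof.
move=> un; have [//|nv] := pselect (exists v, v * u = 1).
have [||a aP] := @ideal_of_prop (fun x => exists v, x = v * u).
- split; first by exists 0; rewrite mul0r.
  by move=> c _ _ [v ->] [w ->]; exists (c * v + w); rewrite mulrDl mulrA.
- by move=> [v uv]; case: nv; exists v.
case/negP: un; apply: (@local_ideal_sub a).
by rewrite aP; apply/asboolP; exists 1; rewrite mul1r.
Qed.

Lemma local_unit1D u v : v * u = 1 -> forall x, x \in n -> exists w, w * (u + x) = 1.
Proof.
move=> vu x xn; apply: local_unit; apply/negP => uxn.
have un : u \in n by rewrite -[u](addrK x) rpredB.
by have := idealMr v un; rewrite vu idealr1.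
Qed.

Hypothesis noethQ : noetherian_rows Q 1.

(** For the generators of [K], the hypothesis is a linear system with matrix
    [1 - t T]; the determinant is [1] modulo [n], hence a unit. *)
Lemma nakayama_ideal (a K : Q -> Prop) t : ideal_prop a -> ideal_prop K ->
  t \in n -> (forall x, K x -> exists2 y, K y & a (x - t * y)) ->
  forall x, K x -> a x.
Proof.
move=> ha hK tn KK.
have [|r [D DP]] := noethQ (P := fun v => K (v 0 0)).
  split; first by rewrite mxE; exact: hK.1.
  by move=> c u v Ku Kv; rewrite !mxE; apply: hK.2.
have KD i : K (D i 0).
  have /(_ (row i D)) := DP; rewrite mxE => -> //.
  by exists (delta_mx 0 i); rewrite rowE.
have /choice[w wP] i : exists w : 'rV[Q]_r, a (D i 0 - t * (w *m D) 0 0).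
  have [y Ky ay] := KK _ (KD i).
  have /DP[z zP] : K ((y%:M : 'rV_1) 0 0) by rewrite mxE eqxx mulr1n.
  by exists z; rewrite -zP mxE eqxx mulr1n.
pose T := \matrix_i w i; pose E := 1%:M - t *: T.
have aED i : a ((E *m D) i 0).
  have := wP i; congr a; rewrite mulmxBl mul1mx -scalemxAl !mxE.
  by congr (_ - _ * _); apply: eq_bigr => j _; rewrite !mxE.
have aD u v : a u -> a v -> a (u + v).
  by move=> au av; rewrite -[u]mul1r; apply: ha.2.
have aMul c u : a u -> a (c * u).
  by move=> au; rewrite -[_ * _]addr0; apply: ha.2 => //; exact: ha.1.
have adet i : a (\det E * D i 0).
  have -> : \det E * D i 0 = (\adj E *m (E *m D)) i 0.
    by rewrite mulmxA mul_adj_mx mul_scalar_mx mxE.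
  by rewrite mxE; elim/big_ind: _ => //; [exact: ha.1 | move=> j _; apply: aMul].
have [c cE] : exists c, c * \det E = 1.
  pose q (x : Q) := qpi n x.
  apply: local_unit; apply/negP => En.
  have : qpi n (\det E) = qpi n 1.
    rewrite -det_map_mx rmorph1 -(det1 _ r); congr (\det _).
    rewrite map_mxB map_mx1 map_mxZ /=.
    suff -> : qpi n t = 0 by rewrite scale0r subr0.
    by rewrite -(rmorph0 (qpi n)); apply/qpi_eq; rewrite subr0.
  move/qpi_eq => h; have : 1 \in n.
    by rewrite -[1](subKr (\det E)) rpredB.
  by rewrite idealr1.
move=> x Kx; have [y] : exists y, (x%:M : 'rV_1) = y *m D.
  by apply/DP; rewrite mxE eqxx mulr1n.
move=> /rowP/(_ 0); rewrite !mxE eqxx mulr1n => ->.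
elim/big_ind: _ => //; first exact: ha.1.
move=> i _; apply: (aMul); rewrite -[D i 0]mul1r -cE -mulrA; exact: aMul (adet i).
Qed.

End Local.

(** * Regular sequences *)

Section RegularSequences.
Variables (Q : comNzRingType) (n : idealr Q).
Hypothesis hn : local_ring n.
Hypothesis noethQ : noetherian_rows Q 1.

Definition adjoin (a : Q -> Prop) (x : Q) : Q -> Prop :=
  fun z => exists v u, a v /\ z = v + u * x.

(** Unlike [regular_sequence], this form is suited to induction on the sequence and
    to swapping its first terms. *)
Fixpoint regular_mod (a : Q -> Prop) (s : seq Q) : Prop :=
  if s is x :: s' then
    (forall y, a (y * x) -> a y) /\ regular_mod (adjoin a x) s'
  else True.

Section IdealProp.
Variable a : Q -> Prop.
Hypothesis ha : ideal_prop a.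

Lemma ideal_propD u v : a u -> a v -> a (u + v).
Proof. by move=> au av; rewrite -[u]mul1r; apply: ha.2. Qed.

Lemma ideal_propM c u : a u -> a (c * u).
Proof. by move=> au; rewrite -[_ * _]addr0; apply: ha.2 => //; exact: ha.1. Qed.

Lemma ideal_propB u v : a u -> a v -> a (u - v).
Proof.
by move=> au av; apply: ideal_propD => //; rewrite -mulN1r; apply: ideal_propM.
Qed.

Lemma ideal_propDl u v : a u -> a (u + v) -> a v.
Proof. by move=> au auv; rewrite -[v](addrK u) [v + u]addrC; apply: ideal_propB. Qed.

Lemma ideal_adjoin x : ideal_prop (adjoin a x).
Proof.
split; first by exists 0, 0; rewrite mul0r addr0; split=> //; exact: ha.1.
move=> c _ _ [v [u [av ->]]] [w [t [aw ->]]].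
exists (c * v + w), (c * u + t); split; first exact: ha.2.
by rewrite mulrDr mulrDl mulrA addrACA.
Qed.

Lemma adjoin_sub x y : a y -> adjoin a x y.
Proof. by exists y, 0; rewrite mul0r addr0. Qed.

End IdealProp.

Lemma adjoinC a x y : adjoin (adjoin a x) y = adjoin (adjoin a y) x.
Proof.
suff H u v z : adjoin (adjoin a u) v z -> adjoin (adjoin a v) u z.
  by apply/funext => z; apply/propext; split; apply: H.
move=> [_ [w [[t [b [at_ ->]]] ->]]]; exists (t + w * v), b.
by rewrite addrAC; split=> //; exists t, w.
Qed.

(** The element [y] is regular modulo [a] by Nakayama's lemma: if [K] is the
    ideal of those [z] with [z * y] in [a], then [K] is [a + x * K]. *)
Lemma regular_mod_swap a x y s : ideal_prop a -> x \in n ->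
  regular_mod a [:: x, y & s] -> regular_mod a [:: y, x & s].
Proof.
move=> ha xn [regx [regy regs]]; split=> [|/=]; last first.
  split; last by rewrite adjoinC.
  move=> z [v [w [av zxE]]].
  have [v' [w' [av' wE]]] : adjoin a x w.
    by apply: regy; exists (- v), z; rewrite zxE addKr -mulN1r; split=> //; apply: ideal_propM.
  exists (z - w' * y), w'; rewrite subrK; split=> //; apply: regx.
  have -> : (z - w' * y) * x = v + y * v'.
    by rewrite mulrBl zxE wE mulrDl -addrA mulrAC addrK mulrC.
  by apply: ideal_propD => //; apply: ideal_propM.
apply: (nakayama_ideal hn noethQ (t := x)) => // [|z].
  split; first by rewrite mul0r; exact: ha.1.
  by move=> c u v au av; rewrite mulrDl -mulrA; apply: ha.2.
move=> azy; have [v [w [av zE]]] : adjoin a x z by apply: regy; apply: adjoin_sub.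
exists w; last by rewrite zE mulrC addrK.
apply: regx; rewrite mulrAC; apply: (@ideal_propDl _ ha (y * v)).
  exact: ideal_propM.
by rewrite [y * v]mulrC -mulrDl -zE.
Qed.

(** By swapping the first two terms if necessary, a unit occurs among the
    coefficients of the tail, unless the sequence has a single term. By induction
    [f] is then regular modulo [a] and the head, and Nakayama's lemma shows that it
    is regular modulo [a]. *)
Lemma unit_combination_regular a (l : seq (Q * Q)) v f : ideal_prop a ->
  (forall p, p \in l -> p.2 \in n) -> regular_mod a [seq p.2 | p <- l] ->
  (exists2 p, p \in l & exists w, w * p.1 = 1) ->
  a v -> f = v + \sum_(p <- l) p.1 * p.2 ->
  forall y, a (y * f) -> a y.
Proof.
move: {2}(size l) (leqnn (size l)) => N.
elim: N => [|N IH] in a v l f *; first by case: l => // _ _ _ _ [].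
move=> sl ha ln hl lu av fE.
have step (p : Q * Q) (l' : seq (Q * Q)) : (size l' <= N)%N -> p.2 \in n ->
    (forall p, p \in l' -> p.2 \in n) ->
    regular_mod a (p.2 :: [seq p.2 | p <- l']) ->
    (exists2 p, p \in l' & exists w, w * p.1 = 1) ->
    f = v + (p.1 * p.2 + \sum_(p <- l') p.1 * p.2) ->
    forall y, a (y * f) -> a y.
  move=> sl' pn l'n [regp regl'] l'u fE'.
  have regf : forall y, adjoin a p.2 (y * f) -> adjoin a p.2 y.
    apply: (IH _ (v + p.1 * p.2) l') => //; first exact: ideal_adjoin.
      by exists v, p.1.
    by rewrite -addrA.
  apply: (nakayama_ideal hn noethQ (t := p.2)) => // [|z azf].
    split; first by rewrite mul0r; exact: ha.1.
    by move=> c u w au aw; rewrite mulrDl -mulrA; apply: ha.2.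
  have [w [u [aw zE]]] : adjoin a p.2 z by apply: regf; apply: adjoin_sub.
  exists u; last by rewrite zE mulrC addrK.
  apply: regp; rewrite mulrAC; apply: (@ideal_propDl _ ha (f * w)).
    exact: ideal_propM.
  by rewrite [f * w]mulrC -mulrDl -zE.
case: l => [|p l] in sl ln hl lu fE *; first by case: lu.
have pn : p.2 \in n by apply: ln; rewrite mem_head.
have l'n q : q \in l -> q.2 \in n by move=> ql; apply: ln; rewrite inE ql orbT.
rewrite big_cons in fE.
have [l'u|nl'u] := pselect (exists2 p, p \in l & exists w, w * p.1 = 1).
  exact: (step p l).
have pu : exists w, w * p.1 = 1.
  by case: lu => q; rewrite inE => /predU1P[->|ql] // qu; case: nl'u; exists q.
case: l => [|q l] in sl ln l'n hl lu nl'u fE *.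
  move=> y; rewrite fE big_nil addr0 mulrDr => ay.
  case: pu => w wp; have /hl.1 : a (y * p.1 * p.2).
    by rewrite -mulrA; apply: ideal_propDl ay => //; apply: ideal_propM.
  by move/(ideal_propM ha w); rewrite mulrCA wp mulr1.
apply: (step q (p :: l)) => //.
- by apply: l'n; rewrite mem_head.
- move=> r; rewrite inE => /predU1P[->//|rl]; apply: l'n.
  by rewrite inE rl orbT.
- exact: regular_mod_swap.
- by exists p => //; rewrite mem_head.
- by rewrite fE; congr (_ + _); rewrite !big_cons addrCA.
Qed.

Lemma submod_spanP (s : seq Q^o) (x : Q^o) : x \in submod_span s <->
  exists a : nat -> Q, x = \sum_(i < size s) a i * s`_i.
Proof.
split=> [/asboolP[a ->]|[a ->]]; last by apply/asboolP; exists (fun i => a i).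
exists (fun k => if insub k is Some i then a i else 0).
by apply: eq_bigr => i _; rewrite valK.
Qed.

Lemma adjoin_span (s : seq Q^o) (x : Q^o) :
  adjoin (fun z => z \in submod_span s) x = (fun z => z \in submod_span (rcons s x) : Prop).
Proof.
apply/funext => z; apply/propext; rewrite submod_spanP size_rcons.
have bE (a : nat -> Q) : \sum_(i < (size s).+1) a i * (rcons s x)`_i =
    \sum_(i < size s) a i * s`_i + a (size s) * x.
  rewrite big_ord_recr /= nth_rcons ltnn eqxx; congr (_ + _).
  by apply: eq_bigr => i _; rewrite nth_rcons ltn_ord.
split=> [[_ [u [/submod_spanP[a ->] ->]]]|[a ->]].
  pose b k := if (k < size s)%N then a k else u.
  exists b; have -> := bE b; rewrite /b ltnn.
  by congr (_ + _); apply: eq_bigr => i _; rewrite ltn_ord.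
have /= -> := bE a; exists (\sum_(i < size s) a i * s`_i), (a (size s)).
by split=> //; apply/submod_spanP; exists a.
Qed.

Lemma regular_sequence_mod (s : seq Q^o) : regular_sequence s ->
  regular_mod (fun z => z = 0) s.
Proof.
move=> [_ hs].
suff H q (p : seq Q^o) : s = p ++ q -> regular_mod (fun z => z \in submod_span p) q.
  have := H s [::] erefl; congr regular_mod; apply/funext => z; apply/propext.
  by rewrite submod_spanP; split=> [[a]|->]; [rewrite big_ord0|exists (fun=> 0); rewrite big_ord0].
elim: q p => [//|x q IH] p sE; split.
  move=> y yx; have := hs (size p); rewrite sE size_cat /= addnS ltnS leq_addr.
  rewrite take_size_cat // nth_cat ltnn subnn /= => /(_ isT y); exact.
by rewrite adjoin_span; apply: IH; rewrite cat_rcons.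
Qed.

(** An element of [I] outside [n * I] is a combination of the regular sequence
    with a unit coefficient. *)
Lemma minimal_generator_regular (s : seq Q^o) (f : Q) :
  regular_sequence s -> {subset s <= n} -> f \in submod_span s ->
  (forall a : nat -> Q, (forall i, (i < size s)%N -> a i \in n) ->
     f <> \sum_(i < size s) a i * s`_i) ->
  forall y, y * f = 0 -> y = 0.
Proof.
move=> hs sn /submod_spanP[a fE] fn.
have [k ks ak] : exists2 k, (k < size s)%N & a k \notin n.
  apply: contrapT => h; apply: (fn a) => // i si; apply: contrapT => /negP ai.
  by apply: h; exists i.
pose l := [seq (a i, s`_i) | i <- iota 0 (size s)].
have l2 : [seq p.2 | p <- l] = s.
  by rewrite -map_comp -[RHS](mkseq_nth 0).
apply: (@unit_combination_regular (fun z => z = 0) l 0) => //.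
- by split=> // c u v -> ->; rewrite mulr0 addr0.
- by move=> p pl; apply: sn; rewrite -l2 map_f.
- by rewrite l2; exact: regular_sequence_mod.
- have [w wE] := local_unit hn ak.
  exists (a k, s`_k); last by exists w.
  by apply/mapP; exists k; rewrite // mem_iota.
- by rewrite add0r big_map fE -[X in iota 0 X]subn0 big_mkord.
Qed.

End RegularSequences.

(** * Rows with polynomial entries *)

Definition rows_in (A : comNzRingType) (l : nat) (P : 'rV[A]_l -> Prop) (r : nat)
  (Z : 'M[A]_(r, l)) : Prop := forall y, P (y *m Z).

Section RowsIn.
Variables (A : comNzRingType) (l : nat) (P : 'rV[A]_l -> Prop).
Hypothesis hP : submodule_pred P.

Lemma rows_inP r (Z : 'M[A]_(r, l)) : (forall i, P (row i Z)) -> rows_in P Z.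
Proof. by move=> h y; apply: submodule_mulmx. Qed.

Lemma rows_in_row r (Z : 'M[A]_(r, l)) i : rows_in P Z -> P (row i Z).
Proof. by move=> h; rewrite rowE. Qed.

Lemma rows_inD r (Y Z : 'M[A]_(r, l)) :
  rows_in P Y -> rows_in P Z -> rows_in P (Y + Z).
Proof. by move=> hY hZ y; rewrite mulmxDr; apply: submoduleD. Qed.

Lemma rows_inB r (Y Z : 'M[A]_(r, l)) :
  rows_in P Y -> rows_in P Z -> rows_in P (Y - Z).
Proof. by move=> hY hZ y; rewrite mulmxBr; apply: submoduleB. Qed.

Lemma rows_inZ r c (Z : 'M[A]_(r, l)) : rows_in P Z -> rows_in P (c *: Z).
Proof. by move=> hZ y; rewrite -scalemxAr; apply: submoduleZ. Qed.

Lemma rows_inM q r (Y : 'M[A]_(q, r)) (Z : 'M[A]_(r, l)) :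
  rows_in P Z -> rows_in P (Y *m Z).
Proof. by move=> hZ y; rewrite mulmxA. Qed.

End RowsIn.

Section PolyRows.
Variable Q : comNzRingType.
Local Notation S := {poly Q}.

Definition ev_mx (c : Q) (r m : nat) (Z : 'M[S]_(r, m)) : 'M[Q]_(r, m) :=
  map_mx (horner_eval c) Z.

Definition const_poly_mx (r m : nat) (Z : 'M[Q]_(r, m)) : 'M[S]_(r, m) :=
  map_mx polyC Z.

Lemma ev_mxM c r m p (Y : 'M[S]_(r, m)) (Z : 'M[S]_(m, p)) :
  ev_mx c (Y *m Z) = ev_mx c Y *m ev_mx c Z.
Proof. exact: map_mxM. Qed.

Lemma ev_mxB c r m (Y Z : 'M[S]_(r, m)) : ev_mx c (Y - Z) = ev_mx c Y - ev_mx c Z.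
Proof. exact: map_mxB. Qed.

Lemma ev_mxZ c r m p (Z : 'M[S]_(r, m)) : ev_mx c (p *: Z) = p.[c] *: ev_mx c Z.
Proof. exact: map_mxZ. Qed.

Lemma ev_constK c r m (Z : 'M[Q]_(r, m)) : ev_mx c (const_poly_mx Z) = Z.
Proof. by apply/matrixP => i j; rewrite !mxE /horner_eval hornerC. Qed.

Lemma ev_XsubC c r m (Z : 'M[S]_(r, m)) : ev_mx c (('X - c%:P) *: Z) = 0.
Proof. by rewrite ev_mxZ hornerXsubC subrr scale0r. Qed.

Lemma ev_mx_eq0 c r m (Z : 'M[S]_(r, m)) :
  ev_mx c Z = 0 -> exists W, Z = ('X - c%:P) *: W.
Proof.
move=> /matrixP hZ.
have /choice[q qP] (ij : 'I_r * 'I_m) : exists q, Z ij.1 ij.2 = q * ('X - c%:P).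
  by apply/factor_theorem; have := hZ ij.1 ij.2; rewrite !mxE => /eqP.
exists (\matrix_(i, j) q (i, j)); apply/matrixP => i j.
by rewrite !mxE (qP (i, j)) mulrC.
Qed.

Lemma ev_mx_const c r m (Z : 'M[S]_(r, m)) :
  exists W, Z = const_poly_mx (ev_mx c Z) + ('X - c%:P) *: W.
Proof.
have [|W WE] := @ev_mx_eq0 c _ _ (Z - const_poly_mx (ev_mx c Z)).
  by rewrite ev_mxB ev_constK subrr.
by exists W; rewrite -WE addrC subrK.
Qed.

Lemma XsubC_mx_inj c r m (Y Z : 'M[S]_(r, m)) :
  ('X - c%:P) *: Y = ('X - c%:P) *: Z -> Y = Z.
Proof.
move=> /matrixP h; apply/matrixP => i j; have := h i j; rewrite !mxE.
exact/monic_lreg/monicXsubC.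
Qed.

(** Evaluation at [c] shows that [Z] vanishes there, so that the factor ['X - c]
    cancels. *)
Lemma XsubC_regular_mod (F : S) c r m (Y Z : 'M[S]_(r, m)) :
  (forall y, y * F.[c] = 0 -> y = 0) ->
  ('X - c%:P) *: Y = F *: Z -> exists Z', Y = F *: Z'.
Proof.
move=> regF YZ; have [|W WE] := @ev_mx_eq0 c _ _ Z.
  have := congr1 (@ev_mx c r m) YZ; rewrite ev_XsubC ev_mxZ => /matrixP h.
  by apply/matrixP => i j; have := h i j; rewrite !mxE mulrC => /esym/regF.
by exists W; apply: (@XsubC_mx_inj c); rewrite YZ WE !scalerA mulrC.
Qed.

(** The extension of the submodule [K] of [Q^m] to [Q[t]^m]. *)
Definition poly_rows (m : nat) (K : 'rV[Q]_m -> Prop) (v : 'rV[S]_m) : Prop :=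
  forall k, K (map_mx (coefp k) v).

Section Extension.
Variables (m : nat) (K : 'rV[Q]_m -> Prop).
Hypothesis hK : submodule_pred K.

Lemma coef_row_scale (p : S) (v : 'rV[S]_m) k :
  map_mx (coefp k) (p *: v) = \sum_(j < k.+1) p`_j *: map_mx (coefp (k - j)) v.
Proof.
apply/rowP => i; rewrite !mxE /coefp summxE coefM.
by apply: eq_bigr => j _; rewrite !mxE.
Qed.

Lemma submodule_poly_rows : submodule_pred (poly_rows K).
Proof.
split=> [k|p u v Ku Kv k]; first by rewrite map_mx0; exact: hK.1.
rewrite map_mxD; apply: submoduleD => //; last exact: Kv.
by rewrite coef_row_scale; apply: submodule_sum => // j _; apply: submoduleZ.
Qed.

Lemma poly_rows_kill (F : S) v :
  (forall k u, K (F`_k *: u)) -> poly_rows K (F *: v).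
Proof. by move=> KF k; rewrite coef_row_scale; apply: submodule_sum. Qed.

Lemma poly_rows_ev c v : poly_rows K v -> K (ev_mx c v).
Proof.
move=> Kv; pose N := (\max_(j < m) size (v ord0 j))%N.
have -> : ev_mx c v = \sum_(k < N) c ^+ k *: map_mx (coefp k) v.
  apply/rowP => j; rewrite mxE summxE /horner_eval (@horner_coef_wide _ N).
    by apply: eq_bigr => k _; rewrite !mxE mulrC.
  exact: (leq_bigmax j).
by apply: submodule_sum => // k _; apply: submoduleZ.
Qed.

Lemma poly_rows_const v : K v -> poly_rows K (const_poly_mx v).
Proof.
move=> Kv k; rewrite (_ : map_mx _ _ = (k == 0)%:R *: v); first exact: submoduleZ.
by apply/rowP => j; rewrite !mxE /coefp coefC; case: eqP; rewrite ?mul1r ?mul0r.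
Qed.

(** The coefficients of [v] are recovered from those of the product from the top
    down, as ['X - c] is monic. *)
Lemma poly_rows_regular c v : poly_rows K (('X - c%:P) *: v) -> poly_rows K v.
Proof.
move=> Kv k; pose N := (\max_(j < m) size (v ord0 j))%N.
have vN i : (N <= i)%N -> K (map_mx (coefp i) v).
  move=> Ni; rewrite (_ : map_mx _ _ = 0); first exact: hK.1.
  apply/rowP => j; rewrite !mxE /coefp nth_default // (leq_trans _ Ni) //.
  exact: (leq_bigmax j).
have vS i : K (map_mx (coefp i.+1) v) -> K (map_mx (coefp i) v).
  move=> Ki; rewrite (_ : map_mx (coefp i) v =
    map_mx (coefp i.+1) (('X - c%:P) *: v) + c *: map_mx (coefp i.+1) v).
    by apply: submoduleD => //; apply: submoduleZ.
  apply/rowP => j; rewrite !mxE /coefp mulrBl coefB coefXM coefCM /=.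
  by rewrite subrK.
have [/vN//|kN] := leqP N k.
suff H i : K (map_mx (coefp (N - i)) v) by rewrite -(subKn (ltnW kN)).
elim: i => [|i IH]; first by rewrite subn0; apply: vN.
have [iN|Ni] := ltnP i N; first by apply: vS; rewrite subnSK.
by rewrite (_ : N - i.+1 = N - i)%N //; apply/eqP; rewrite eqn_leq leq_sub2l // (eqP Ni).
Qed.

Lemma rows_in_const r (Z : 'M[Q]_(r, m)) :
  rows_in K Z -> rows_in (poly_rows K) (const_poly_mx Z).
Proof.
move=> hZ; apply: rows_inP => [|i]; first exact: submodule_poly_rows.
by rewrite /const_poly_mx -map_row; apply: poly_rows_const; exact: rows_in_row.
Qed.

Lemma rows_in_ev c r (Z : 'M[S]_(r, m)) :
  rows_in (poly_rows K) Z -> rows_in K (ev_mx c Z).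
Proof.
move=> hZ y; rewrite -(ev_constK c y) -ev_mxM; exact: poly_rows_ev.
Qed.

Lemma rows_in_regular c r (Z : 'M[S]_(r, m)) :
  rows_in (poly_rows K) (('X - c%:P) *: Z) -> rows_in (poly_rows K) Z.
Proof. by move=> hZ y; apply: (@poly_rows_regular c); rewrite scalemxAr. Qed.

Lemma rows_in_lift c r (Z : 'M[S]_(r, m)) : rows_in K (ev_mx c Z) ->
  exists W, rows_in (poly_rows K) (Z - ('X - c%:P) *: W).
Proof.
have [W {2}->] := ev_mx_const c Z => hZ.
by exists W; rewrite addrK; apply: rows_in_const.
Qed.

End Extension.

End PolyRows.

(** * Resolutions by matrices *)

Section MatrixResolution.
Variables (A : comNzRingType) (F : A).
Hypothesis noethA : forall m, noetherian_rows A m.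

(** The rows killed by [D] over [A / F]. *)
Definition syzygy (r c : nat) (D : 'M[A]_(r, c)) : 'rV[A]_r -> Prop :=
  fun x => exists w, x *m D = F *: w.

Lemma submodule_syzygy r c (D : 'M[A]_(r, c)) : submodule_pred (syzygy D).
Proof.
split; first by exists 0; rewrite mul0mx scaler0.
move=> a u v [w wE] [z zE]; exists (a *: w + z).
by rewrite mulmxDl -scalemxAl wE zE scalerDr !scalerA mulrC.
Qed.

Record stage := Stage { stage_rows; stage_cols; stage_mx : 'M[A]_(stage_rows, stage_cols) }.

Definition next_rows (T : stage) : nat :=
  sval (cid (noethA (submodule_syzygy (stage_mx T)))).

Definition next_mx (T : stage) : 'M[A]_(next_rows T, stage_rows T) :=
  sval (cid (svalP (cid (noethA (submodule_syzygy (stage_mx T)))))).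

Lemma next_mxP (T : stage) x :
  syzygy (stage_mx T) x <-> exists y, x = y *m next_mx T.
Proof. exact: (svalP (cid (svalP (cid (noethA (submodule_syzygy (stage_mx T))))))). Qed.

Variables (r m : nat) (D0 : 'M[A]_(r, m)).

(** Matrices of a free resolution, over [A / F], of the cokernel of [D0] when [F]
    kills it; the ranks are read off the stages so that consecutive matrices have
    composable types by conversion. *)
Definition res_stage (i : nat) : stage :=
  iter i (fun T => Stage (next_mx T)) (Stage D0).

Definition res_rank (i : nat) : nat := stage_cols (res_stage i).

Definition res_mx (i : nat) : 'M[A]_(res_rank i.+1, res_rank i) :=
  stage_mx (res_stage i).

Lemma res_mxP i x : syzygy (res_mx i) x <-> exists y, x = y *m res_mx i.+1.
Proof. exact: next_mxP. Qed.

End MatrixResolution.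

(** * Specializing a one-parameter family of hypersurfaces *)

Section Family.
Variables (Q : comNzRingType) (b : nat -> nat).
Local Notation S := {poly Q}.
Variables (D : forall i, 'M[S]_(b i.+1, b i)) (F : S).
Variable L : 'rV[Q]_(b 0) -> Prop.
Hypothesis hL : submodule_pred L.
Hypothesis LF : forall k u, L (F`_k *: u).
Hypothesis D0P : forall x, poly_rows L x <-> exists y, x = y *m D 0.
Hypothesis DSP : forall i x, syzygy F (D i) x <-> exists y, x = y *m D i.+1.

(** The images of the resolution: all have the form of a kernel but the first one,
    which is the module of relations of [M[t]]. *)
Definition rel_rows (i : nat) : 'rV[S]_(b i) -> Prop :=
  match i with 0 => poly_rows L | j.+1 => syzygy F (D j) end.

Definition ev_rel_rows (c : Q) (i : nat) : 'rV[Q]_(b i) -> Prop :=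
  match i with 0 => L | j.+1 => syzygy F.[c] (ev_mx c (D j)) end.

Lemma rel_rowsP i x : rel_rows x <-> exists y, x = y *m D i.
Proof. by case: i x => [|i] x; [exact: D0P | exact: DSP]. Qed.

Lemma rel_rows_kill i (x : 'rV[S]_(b i)) : rel_rows (F *: x).
Proof.
case: i x => [|i] x; first exact: poly_rows_kill.
by exists (x *m D i); rewrite scalemxAl.
Qed.

Lemma rel_rows_ev c i (x : 'rV[S]_(b i)) : rel_rows x -> ev_rel_rows c (ev_mx c x).
Proof.
case: i x => [|i] x /=; first exact: poly_rows_ev.
by move=> [w wE]; exists (ev_mx c w); rewrite -ev_mxM wE ev_mxZ.
Qed.

Lemma res_mx_comp i : exists W, D i.+1 *m D i = F *: W.
Proof.
have /choice[w wP] k : exists w, row k (D i.+1) *m D i = F *: w.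
  by apply/DSP; exists (delta_mx 0 k); rewrite rowE.
exists (\matrix_k w k); apply/row_matrixP => k.
by rewrite row_mul wP linearZ /= rowK.
Qed.

Section Specialization.
Variable c : Q.
Hypothesis regF : forall y, y * F.[c] = 0 -> y = 0.

Lemma rel_rows_regular i (x : 'rV[S]_(b i)) :
  rel_rows (('X - c%:P) *: x) -> rel_rows x.
Proof.
case: i x => [|i] x /=; first exact: poly_rows_regular.
by move=> [w]; rewrite -scalemxAl => /(XsubC_regular_mod regF).
Qed.

(** Reduction modulo ['X - c] keeps the matrices exact, because ['X - c] is regular
    on all the cokernels involved. *)
Lemma ev_rel_rowsP i x : ev_rel_rows c x <-> exists y, x = y *m ev_mx c (D i).
Proof.
split=> [cx|[y ->]]; last first.
  rewrite -(ev_constK c y) -ev_mxM; apply/rel_rows_ev/rel_rowsP.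
  by exists (const_poly_mx y).
suff [v /rel_rowsP[y ->] <-] : exists2 v, rel_rows v & ev_mx c v = x.
  by exists (ev_mx c y); rewrite ev_mxM.
case: i x cx => [|i] x /=.
  by move=> Lx; exists (const_poly_mx x); [apply: poly_rows_const | rewrite ev_constK].
move=> [w wE].
have [|v vE] := @ev_mx_eq0 _ c _ _ (const_poly_mx x *m D i - F *: const_poly_mx w).
  by rewrite ev_mxB ev_mxM ev_mxZ !ev_constK wE subrr.
have /rel_rowsP[z zE] : rel_rows v.
  apply: rel_rows_regular; rewrite -vE; have /rel_rowsP[y yE] := rel_rows_kill (const_poly_mx w).
  by apply/rel_rowsP; exists (const_poly_mx x - y); rewrite mulmxBl yE.
exists (const_poly_mx x - ('X - c%:P) *: z); last first.
  by rewrite ev_mxB ev_constK ev_XsubC subr0.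
exists (const_poly_mx w).
by rewrite mulmxBl -scalemxAl -zE -vE opprB addrC subrK.
Qed.

End Specialization.

(** * Cohomology of the family *)

Section Cohomology.
Variables (l : nat) (K : 'rV[Q]_l -> Prop).
Hypothesis hK : submodule_pred K.
Hypothesis KF : forall k u, K (F`_k *: u).
Let hKt : submodule_pred (poly_rows K) := submodule_poly_rows hK.

(** Cochains of degree [j.+1], so that there is always an incoming differential. *)
Definition cocycle_mx (j : nat) (Z : 'M[S]_(b j.+1, l)) : Prop :=
  rows_in (poly_rows K) (D j.+1 *m Z).

Definition coboundary_mx (j : nat) (Z : 'M[S]_(b j.+1, l)) : Prop :=
  exists U, rows_in (poly_rows K) (Z - D j *m U).

Definition vanishing_at (c : Q) (j : nat) : Prop :=
  forall Z : 'M[Q]_(b j.+1, l), rows_in K (ev_mx c (D j.+1) *m Z) ->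
  exists U, rows_in K (Z - ev_mx c (D j) *m U).

Lemma rows_in_killM q (W : 'M[S]_(q, l)) : rows_in (poly_rows K) (F *: W).
Proof. by move=> y; rewrite -scalemxAr; apply: poly_rows_kill. Qed.

Lemma coboundary_mxD j (Y Z : 'M[S]_(b j.+1, l)) :
  coboundary_mx Y -> coboundary_mx Z -> coboundary_mx (Y + Z).
Proof.
move=> [U hU] [V hV]; exists (U + V).
by rewrite mulmxDr opprD addrACA; apply: rows_inD.
Qed.

Lemma coboundary_mxZ j p (Z : 'M[S]_(b j.+1, l)) :
  coboundary_mx Z -> coboundary_mx (p *: Z).
Proof.
by move=> [U hU]; exists (p *: U); rewrite -scalemxAr -scalerBr; apply: rows_inZ.
Qed.

Lemma coboundary_mx_cocycle j (Z : 'M[S]_(b j.+1, l)) :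
  coboundary_mx Z -> cocycle_mx Z.
Proof.
move=> [U hU]; rewrite /cocycle_mx -[Z](subrK (D j *m U)) mulmxDr.
apply: rows_inD => //; first exact: rows_inM.
have [W WE] := res_mx_comp j.
by rewrite mulmxA WE -scalemxAl; apply: rows_in_killM.
Qed.

Lemma cocycle_mxB j (Y Z : 'M[S]_(b j.+1, l)) :
  cocycle_mx Y -> cocycle_mx Z -> cocycle_mx (Y - Z).
Proof. by move=> hY hZ; rewrite /cocycle_mx mulmxBr; apply: rows_inB. Qed.

Lemma cocycle_mxZ j p (Z : 'M[S]_(b j.+1, l)) :
  cocycle_mx Z -> cocycle_mx (p *: Z).
Proof. by move=> hZ; rewrite /cocycle_mx -scalemxAr; apply: rows_inZ. Qed.

Definition XsubC_surjective (c : Q) (j : nat) : Prop :=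
  forall Z : 'M[S]_(b j.+1, l), cocycle_mx Z ->
  exists2 Z', cocycle_mx Z' & coboundary_mx (Z - ('X - c%:P) *: Z').

Definition XsubC_injective (c : Q) (j : nat) : Prop :=
  forall Z : 'M[S]_(b j.+1, l), cocycle_mx Z ->
  coboundary_mx (('X - c%:P) *: Z) -> coboundary_mx Z.

(** A cocycle becomes a coboundary modulo ['X - c], and the quotient by ['X - c] of
    the difference is a cocycle as ['X - c] is regular on [N[t]]. *)
Lemma vanishing_surjective c j : vanishing_at c j -> XsubC_surjective c j.
Proof.
move=> van Z hZ; have [|U hU] := van (ev_mx c Z).
  by rewrite -ev_mxM; apply: rows_in_ev.
have [|Z' hZ'] := rows_in_lift hK (c := c) (Z := Z - D j *m const_poly_mx U).
  by rewrite ev_mxB ev_mxM ev_constK.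
have cZ' : coboundary_mx (Z - ('X - c%:P) *: Z').
  by exists (const_poly_mx U); rewrite addrAC.
exists Z' => //; apply: (rows_in_regular hK (c := c)); rewrite scalemxAr.
by rewrite -[_ *: Z'](subKr Z); apply: cocycle_mxB => //; apply: coboundary_mx_cocycle.
Qed.

(** The connecting homomorphism: a cocycle [z] at [c] lifts to a cochain with
    coboundary ['X - c] times a cocycle [W]. Injectivity makes [W] a coboundary, so
    that the lift can be corrected to a cocycle. *)
Lemma surjective_injective_vanishing c j :
  XsubC_surjective c j -> XsubC_injective c j.+1 -> vanishing_at c j.
Proof.
move=> surj inj z hz; pose Z := const_poly_mx z.
have [|W hW] := rows_in_lift hK (c := c) (Z := D j.+1 *m Z).
  by rewrite ev_mxM ev_constK.
have cW : coboundary_mx (('X - c%:P) *: W).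
  exists Z; rewrite -opprB -scaleN1r; exact: rows_inZ.
have [|V hV] := inj W _ cW.
  apply: (rows_in_regular hK (c := c)); rewrite scalemxAr.
  exact: coboundary_mx_cocycle.
have cZV : cocycle_mx (Z - ('X - c%:P) *: V).
  rewrite /cocycle_mx mulmxBr -scalemxAr -(subrK (('X - c%:P) *: W) (D j.+1 *m Z)).
  by rewrite -addrA -scalerBr; apply: rows_inD => //; apply: rows_inZ.
have [Z' _ [U hU]] := surj _ cZV.
exists (ev_mx c U); have := rows_in_ev hK c hU.
by rewrite !ev_mxB ev_mxM !ev_XsubC !subr0 ev_constK.
Qed.

Hypothesis noethS : forall m, noetherian_rows S m.

(** If ['X - c] acts surjectively on the finitely generated cohomology, then the
    determinant trick gives an annihilator of the form [det (1 - ('X - c) T)]. *)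
Lemma surjective_annihilator c j : XsubC_surjective c j ->
  exists2 p : S, p.[c] = 1 &
    forall Z : 'M[S]_(b j.+1, l), cocycle_mx Z -> coboundary_mx (p *: Z).
Proof.
move=> surj.
have [|r [G GP]] := noethS (P := fun v => cocycle_mx (vec_mx v : 'M_(b j.+1, l))).
  split=> [|a u v hu hv].
    rewrite /cocycle_mx linear0 mulmx0 -(scale0r 0); apply: rows_inZ => // y.
    by rewrite mulmx0; exact: hKt.1.
  rewrite linearD linearZ /cocycle_mx mulmxDr /=.
  by apply: rows_inD => //; apply: cocycle_mxZ.
have hG i : cocycle_mx (vec_mx (row i G) : 'M_(b j.+1, l)).
  by apply/GP; exists (delta_mx 0 i); rewrite rowE.
have /choice[w wP] i : exists w,
    coboundary_mx (vec_mx (row i G) - ('X - c%:P) *: (vec_mx (w *m G) : 'M_(b j.+1, l))).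
  have [Z' hZ' cZ'] := surj _ (hG i).
  have /GP[w wE] : cocycle_mx (vec_mx (mxvec Z') : 'M_(b j.+1, l)) by rewrite mxvecK.
  by exists w; rewrite -wE mxvecK.
pose T := \matrix_i w i; pose E := 1%:M - ('X - c%:P) *: T.
have hE y : coboundary_mx (vec_mx (y *m (E *m G)) : 'M_(b j.+1, l)).
  rewrite mulmx_sum_row linear_sum /=.
  elim/big_ind: _ => //.
  - by exists 0; rewrite mulmx0 subr0 => y'; rewrite mulmx0; exact: hKt.1.
  - exact: coboundary_mxD.
  - move=> i _; rewrite linearZ /=; apply: coboundary_mxZ.
    have := wP i; rewrite -linearZ -linearB /=; congr (coboundary_mx (vec_mx _)).
    rewrite /E mulmxBl mul1mx -scalemxAl; apply/rowP => k; rewrite !mxE.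
    by congr (_ - _ * _); apply: eq_bigr => t _; rewrite mxE.
exists (\det E).
  rewrite -[LHS]/(horner_eval c _) -det_map_mx -[RHS](det1 _ r); congr (\det _).
  by rewrite -/(ev_mx c _) ev_mxB ev_XsubC subr0 /ev_mx map_mx1.
move=> Z hZ; have [y yE] : exists y, mxvec Z = y *m G by apply/GP; rewrite mxvecK.
have -> : \det E *: Z = vec_mx ((y *m \adj E) *m (E *m G)).
  rewrite mulmxA -(mulmxA y) mul_adj_mx mul_mx_scalar -scalemxAl -yE.
  by rewrite linearZ /= mxvecK.
exact: hE.
Qed.

(** As [p] acts by zero on cohomology and is [p.[c]] modulo ['X - c], the unit [p.[c]]
    acts as a multiple of ['X - c]. *)
Lemma annihilator_bijective c j (p : S) (u : Q) : u * p.[c] = 1 ->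
  (forall Z : 'M[S]_(b j.+1, l), cocycle_mx Z -> coboundary_mx (p *: Z)) ->
  XsubC_surjective c j /\ XsubC_injective c j.
Proof.
move=> up pZ; have [q qE] : exists q, p - p.[c]%:P = q * ('X - c%:P).
  by apply/factor_theorem; rewrite rootE hornerD hornerN hornerC subrr.
have ZE (Z : 'M[S]_(b j.+1, l)) :
    Z = u%:P *: (p *: Z) - ('X - c%:P) *: ((u%:P * q) *: Z).
  rewrite !scalerA -scalerBl mulrCA [_ * q]mulrC -qE mulrBr opprB addrC subrK.
  by rewrite -polyCM up scale1r.
split=> Z hZ.
  exists (- ((u%:P * q) *: Z)).
    by rewrite -scaleNr; apply: cocycle_mxZ.
  by rewrite {1}[Z]ZE scalerN opprK subrK; apply: coboundary_mxZ; apply: pZ.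
move=> cZ; rewrite [Z]ZE; apply: coboundary_mxD.
  by apply: coboundary_mxZ; apply: pZ.
by rewrite -scaleN1r !scalerA mulrC mulrA -scalerA; apply: coboundary_mxZ.
Qed.

Variable n : idealr Q.
Hypothesis hn : local_ring n.

(** The annihilator [p] obtained at [c0] satisfies [p.[c0] = 1], hence its value at
    [c1] is [1] modulo [n]. *)
Lemma vanishing_specialization c0 c1 j0 : c0 - c1 \in n ->
  (forall j, (j0 <= j)%N -> vanishing_at c0 j) ->
  forall j, (j0 <= j)%N -> vanishing_at c1 j.
Proof.
move=> c01 van.
have bij j : (j0 <= j)%N -> XsubC_surjective c1 j /\ XsubC_injective c1 j.
  move=> j0j; have [p p0 pZ] := surjective_annihilator (vanishing_surjective (van j j0j)).
  have [q qE] : exists q, p - p.[c1]%:P = q * ('X - c1%:P).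
    by apply/factor_theorem; rewrite rootE hornerD hornerN hornerC subrr.
  have [u up] : exists u, u * (1 + - (q.[c0] * (c0 - c1))) = 1.
    by apply: (local_unit1D hn (mulr1 1)); rewrite rpredN; apply: idealMr.
  apply: annihilator_bijective pZ; apply: etrans up; congr (_ * _).
  have := congr1 (horner^~ c0) qE; rewrite hornerM hornerXsubC => <-.
  by rewrite hornerD hornerN hornerC p0 opprB addrC subrK.
move=> j j0j; apply: surjective_injective_vanishing; first by case: (bij j j0j).
by case: (bij j.+1 (leqW j0j)).
Qed.

End Cohomology.
End Family.

(** * Comparison of projective resolutions *)

Section Image.
Variables (A : comNzRingType) (X Y : lmodType A) (g : {linear X -> Y}).

Definition im_pred : {pred Y} := fun y => `[< exists x, g x = y >].

Fact im_pred_submod : GRing.submod_closed im_pred.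
Proof.
split; first by apply/asboolP; exists 0; rewrite linear0.
move=> c _ _ /asboolP[u <-] /asboolP[v <-]; apply/asboolP.
by exists (c *: u + v); rewrite linearP.
Qed.

HB.instance Definition _ :=
  GRing.isSubmodClosed.Build A Y im_pred (GRing.submod_closed_semi im_pred_submod).

Record im_mod := ImMod { im_val : Y; _ : im_pred im_val }.

HB.instance Definition _ := [isSub for im_val].
HB.instance Definition _ := [Choice of im_mod by <:].
HB.instance Definition _ := [SubChoice_isSubLmodule of im_mod by <:].

Definition im_corestrict (P : Type) (u : P -> Y) (h : forall p, exists x, g x = u p) :
  P -> im_mod := fun p => ImMod (introT (asboolP _) (h p)).

Fact im_corestrict_linear (P : lmodType A) (u : {linear P -> Y}) h :
  linear (im_corestrict (u := u) h).
Proof. by move=> c x y; apply: val_inj; rewrite /= linearP. Qed.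

HB.instance Definition _ (P : lmodType A) (u : {linear P -> Y}) h :=
  GRing.isLinear.Build A P im_mod *:%R (im_corestrict (u := u) h)
    (im_corestrict_linear (u := u) h).

(** The definition of projective only lifts along surjections; restricting the
    target to the image of [g] removes this limitation. *)
Lemma projective_lift (P : lmodType A) (u : {linear P -> Y}) :
  projective P -> (forall p, exists x, g x = u p) ->
  exists w : {linear P -> X}, forall p, g (w p) = u p.
Proof.
move=> hP h; have gi x : exists x', g x' = g x by exists x.
have [|w wE] := hP _ _ (im_corestrict gi : {linear _ -> _})
                       (im_corestrict h : {linear _ -> _}).
  by case=> y /[dup] /asboolP[x <-] yP; exists x; apply: val_inj.
by exists w => p; have := congr1 val (wE p).
Qed.

End Image.

Section Comparison.
Variables (A : comNzRingType) (M N : lmodType A).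

Lemma res_diff0 (P : proj_resolution M) (x : res_mod P 1) :
  res_aug P (res_diff P 0 x) = 0.
Proof. by apply/res_exact0; exists x. Qed.

Lemma res_diffS (P : proj_resolution M) i (x : res_mod P i.+2) :
  res_diff P i (res_diff P i.+1 x) = 0.
Proof. by apply/res_exactS; exists x. Qed.

Section ChainMap.
Variables P G : proj_resolution M.

(** Two consecutive components of a chain map; keeping both lets the whole map be
    defined by recursion, each step choosing one new component. *)
Definition chain_square (i : nat)
    (p : {linear res_mod P i -> res_mod G i} *
         {linear res_mod P i.+1 -> res_mod G i.+1}) : Prop :=
  forall x, res_diff G i (p.2 x) = p.1 (res_diff P i x).

Lemma chain_square_next i (p : {p | chain_square (i := i) p}) :
  exists w, chain_square (i := i.+1) ((sval p).2, w).
Proof.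
case: p => -[u v] /= uv.
have [|w wE] := projective_lift (g := res_diff G i.+1)
    (u := v \o res_diff P i.+1 : {linear _ -> _}) (res_projective (p := P) (n := i.+2)).
  by move=> x; apply/res_exactS; rewrite uv /= res_diffS linear0.
by exists w.
Qed.

Lemma chain_map_exists :
  exists phi : forall i, {linear res_mod P i -> res_mod G i},
    (forall x, res_aug G (phi 0%N x) = res_aug P x) /\
    (forall i x, res_diff G i (phi i.+1 x) = phi i (res_diff P i x)).
Proof.
have [|u uE] := projective_lift (g := res_aug G) (u := res_aug P)
    (res_projective (p := P) (n := 0)).
  by move=> x; apply: res_aug_surj.
have [|v vE] := projective_lift (g := res_diff G 0)
    (u := u \o res_diff P 0 : {linear _ -> _}) (res_projective (p := P) (n := 1)).
  by move=> x; apply/res_exact0; rewrite uE res_diff0.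
pose start : {p | chain_square (i := 0) p} := exist _ (u, v) vE.
pose next i (p : {p | chain_square (i := i) p}) : {p | chain_square (i := i.+1) p} :=
  exist _ ((sval p).2, sval (cid (chain_square_next p)))
    (svalP (cid (chain_square_next p))).
pose phi := fix phi i : {p | chain_square (i := i) p} :=
  if i is j.+1 then next j (phi j) else start.
exists (fun i => (sval (phi i)).1); split=> // i x.
exact: (svalP (phi i)).
Qed.

End ChainMap.

Lemma chain_homotopy_exists (P : proj_resolution M)
    (eps : forall i, {linear res_mod P i -> res_mod P i}) :
  (forall x, res_aug P (eps 0%N x) = 0) ->
  (forall i x, res_diff P i (eps i.+1 x) = eps i (res_diff P i x)) ->
  forall i, exists h : {linear res_mod P i -> res_mod P i.+1},
    forall x, res_diff P i (eps i.+1 x - h (res_diff P i x)) = 0.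
Proof.
move=> eps0 epsS; elim=> [|i [h hE]].
  have [|h hE] := projective_lift (g := res_diff P 0) (u := eps 0%N)
      (res_projective (p := P) (n := 0)).
    by move=> x; apply/res_exact0.
  by exists h => x; rewrite linearB epsS hE subrr.
have [|k kE] := projective_lift (g := res_diff P i.+1)
    (u := (eps i.+1 \- (h \o res_diff P i)) : {linear _ -> _})
    (res_projective (p := P) (n := i.+1)).
  by move=> x; apply/res_exactS; rewrite hE.
by exists k => x; rewrite linearB epsS kE /= res_diffS linear0 subr0 subrr.
Qed.

(** Chain maps [phi] from [P] to [G] and [psi] back give a homotopy from the identity
    to [psi \o phi]; a cocycle [g] then differs by a coboundary from
    [g \o psi \o phi], and [g \o psi] is a coboundary by hypothesis. *)
Lemma cohomology_vanishing_transfer (P G : proj_resolution M) i :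
  (forall g : {linear res_mod G i.+1 -> N}, Hom_cocycle g -> Hom_coboundary g) ->
  forall g : {linear res_mod P i.+1 -> N}, Hom_cocycle g -> Hom_coboundary g.
Proof.
move=> vanG g gc.
have [phi [phi0 phiS]] := chain_map_exists P G.
have [psi [psi0 psiS]] := chain_map_exists G P.
have [||h hE] := @chain_homotopy_exists P
    (fun j => (idfun \- (psi j \o phi j)) : {linear _ -> _}) _ _ i.
- by move=> x; rewrite /= linearB /= psi0 phi0 subrr.
- by move=> j x; rewrite /= linearB /= psiS phiS.
have [|u uE] := vanG (g \o psi i.+1 : {linear _ -> _}).
  by move=> x; rewrite /= -psiS gc.
exists ((u \o phi i) \+ (g \o h) : {linear _ -> _}) => x.
have /res_exactS[y yE] := hE x.
have : g (x - psi i.+1 (phi i.+1 x) - h (res_diff P i x)) = 0 by rewrite -yE gc.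
rewrite !linearB /= => /eqP; rewrite subr_eq add0r subr_eq => /eqP ->.
have /= -> := uE (phi i.+1 x).
by rewrite phiS addrC.
Qed.

End Comparison.

(** * Free modules *)

Section RowComb.
Variables (A : comNzRingType) (X : lmodType A) (b : nat) (x : 'I_b -> X).

Definition row_comb (v : 'rV[A]_b) : X := \sum_i v 0 i *: x i.

Fact row_comb_linear : linear row_comb.
Proof.
move=> c u v; rewrite /row_comb scaler_sumr -big_split /=.
by apply: eq_bigr => i _; rewrite !mxE scalerDl scalerA.
Qed.

HB.instance Definition _ :=
  GRing.isLinear.Build A 'rV[A]_b X *:%R row_comb row_comb_linear.

End RowComb.

Lemma row_combE (A : comNzRingType) (X : lmodType A) b (g : {linear 'rV[A]_b -> X}) v :
  g v = row_comb (fun i => g (delta_mx 0 i)) v.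
Proof.
rewrite {1}[v]row_sum_delta linear_sum; apply: eq_bigr => i _.
by rewrite linearZ.
Qed.

Lemma projective_row (A : comNzRingType) (b : nat) : projective 'rV[A]_b.
Proof.
move=> X Y g u gsurj.
have /choice[x xE] i : exists x, g x = u (delta_mx 0 i) by exact: gsurj.
exists (row_comb x : {linear _ -> _}) => v; rewrite [RHS]row_combE linear_sum.
by apply: eq_bigr => i _; rewrite linearZ /= xE.
Qed.

(** * Modules over [Q / a] presented by submodules of [Q^m] *)

Section Presentation.
Variables (Q : comNzRingType) (a : idealr Q).
Local Notation B := {ideal_quot a}.

(** The presentation is over [Q] and not over [Q / a]: the same [L] then presents the
    module over all the quotients of [Q] by ideals contained in [a]. *)
Definition presents (M : lmodType B) (m : nat) (L : 'rV[Q]_m -> Prop)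
    (e : 'rV[Q]_m -> M) : Prop :=
  [/\ forall c u v, e (c *: u + v) = qpi a c *: e u + e v,
      forall y, exists x, e x = y & forall x, e x = 0 <-> L x].

Definition qpi_mx (r m : nat) (Z : 'M[Q]_(r, m)) : 'M[B]_(r, m) := map_mx (qpi a) Z.

Lemma qpi_mxM r m p (Y : 'M[Q]_(r, m)) (Z : 'M[Q]_(m, p)) :
  qpi_mx (Y *m Z) = qpi_mx Y *m qpi_mx Z.
Proof. exact: map_mxM. Qed.

Lemma qpi_mx_surj r m (Z : 'M[B]_(r, m)) : exists Y, Z = qpi_mx Y.
Proof.
by exists (map_mx repr Z); apply/matrixP => i j; rewrite !mxE qpi_repr.
Qed.

Section MatrixMaps.
Variables (N : lmodType B) (l : nat) (K : 'rV[Q]_l -> Prop) (e : 'rV[Q]_l -> N).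
Hypothesis hN : presents K e.

Lemma presents_submodule : submodule_pred K.
Proof.
have [eP _ eK] := hN; split.
  by apply/eK; have := eP (-1) 0 0; rewrite scaler0 addr0 rmorphN1 scaleN1r addNr.
by move=> c u v /eK eu /eK ev; apply/eK; rewrite eP eu ev scaler0 addr0.
Qed.

Lemma presents_sum r (c : 'I_r -> Q) (v : 'I_r -> 'rV[Q]_l) :
  e (\sum_i c i *: v i) = \sum_i qpi a (c i) *: e (v i).
Proof.
have [eP _ eK] := hN.
elim/big_ind2: _ => [|u x v' y <- <-|i _].
- by apply/eK; exact: presents_submodule.1.
- by have := eP 1 x y; rewrite scale1r rmorph1 scale1r.
- have e0 : e 0 = 0 by apply/eK; exact: presents_submodule.1.
  by rewrite -[_ *: _]addr0 eP e0 addr0.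
Qed.

Definition mx_map (r : nat) (Z : 'M[Q]_(r, l)) : {linear 'rV[B]_r -> N} :=
  row_comb (fun i => e (row i Z)).

Lemma mx_mapE r (Z : 'M[Q]_(r, l)) x : mx_map Z (qpi_mx x) = e (x *m Z).
Proof.
rewrite mulmx_sum_row presents_sum; apply: eq_bigr => i _; by rewrite mxE.
Qed.

Lemma mx_map_surj r (g : {linear 'rV[B]_r -> N}) :
  exists Z, forall x, g x = mx_map Z x.
Proof.
have [_ eS _] := hN.
have /choice[z zE] i := eS (g (delta_mx 0 i)).
exists (\matrix_i z i) => x; rewrite row_combE; apply: eq_bigr => i _.
by rewrite rowK zE.
Qed.

End MatrixMaps.

Variables (f : Q) (af : forall x, (x \in a) <-> exists y, x = f * y).

Lemma qpi_mx_eq0 r m (Z : 'M[Q]_(r, m)) : qpi_mx Z = 0 <-> exists W, Z = f *: W.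
Proof.
have q0 x : qpi a x = 0 <-> exists y, x = f * y.
  by rewrite -af -[x in x \in a]subr0 -qpi_eq rmorph0.
split=> [/matrixP h|[W ->]]; last first.
  by apply/matrixP => i j; rewrite !mxE; apply/q0; exists (W i j).
have /choice[w wE] (ij : 'I_r * 'I_m) : exists y, Z ij.1 ij.2 = f * y.
  by apply/q0; have := h ij.1 ij.2; rewrite !mxE.
by exists (\matrix_(i, j) w (i, j)); apply/matrixP => i j; rewrite !mxE -(wE (i, j)).
Qed.

Section Resolution.
Variables (b : nat -> nat) (D : forall i, 'M[Q]_(b i.+1, b i)).
Variables (M : lmodType B) (L : 'rV[Q]_(b 0) -> Prop) (eM : 'rV[Q]_(b 0) -> M).
Hypothesis hM : presents L eM.
Hypothesis D0P : forall x, L x <-> exists y, x = y *m D 0.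
Hypothesis DSP : forall i x, syzygy f (D i) x <-> exists y, x = y *m D i.+1.

Definition mx_diff (i : nat) : {linear 'rV[B]_(b i.+1) -> 'rV[B]_(b i)} :=
  mulmxr (qpi_mx (D i)).

Lemma mx_augE x : mx_map eM 1%:M (qpi_mx x) = eM x.
Proof. by rewrite (mx_mapE hM) mulmx1. Qed.

Lemma mx_aug_surj y : exists x, mx_map eM 1%:M x = y.
Proof.
by have [_ eS _] := hM; have [x <-] := eS y; exists (qpi_mx x); rewrite mx_augE.
Qed.

Lemma mx_exact0 x : mx_map eM 1%:M x = 0 <-> exists y, mx_diff 0 y = x.
Proof.
have [_ _ eK] := hM; split=> [|[y <-]].
  have [x' ->] := qpi_mx_surj x; rewrite mx_augE => /eK/D0P[y ->].
  by exists (qpi_mx y); rewrite /mx_diff /= qpi_mxM.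
have [y' ->] := qpi_mx_surj y; rewrite /mx_diff /= -qpi_mxM mx_augE.
by apply/eK/D0P; exists y'.
Qed.

Lemma mx_exactS i x : mx_diff i x = 0 <-> exists y, mx_diff i.+1 y = x.
Proof.
split=> [|[y <-]].
  have [x' ->] := qpi_mx_surj x; rewrite /mx_diff /= -qpi_mxM => /qpi_mx_eq0/DSP[y ->].
  by exists (qpi_mx y); rewrite qpi_mxM.
have [y' ->] := qpi_mx_surj y; rewrite /mx_diff /= -!qpi_mxM.
by apply/qpi_mx_eq0/DSP; exists y'.
Qed.

Definition mx_resolution : proj_resolution M :=
  @ProjResolution B M (fun i => 'rV[B]_(b i)) mx_diff (mx_map eM 1%:M)
    (fun i => @projective_row B (b i)) mx_aug_surj mx_exact0 mx_exactS.

Variables (N : lmodType B) (l : nat) (K : 'rV[Q]_l -> Prop) (eN : 'rV[Q]_l -> N).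
Hypothesis hN : presents K eN.

(** Homomorphisms from a free module to [N] are matrices modulo those with rows
    in [K]. *)
Lemma mx_vanishingP j :
  (forall g : {linear res_mod mx_resolution j.+1 -> N},
     Hom_cocycle g -> Hom_coboundary g) <->
  (forall Z : 'M[Q]_(b j.+1, l), rows_in K (D j.+1 *m Z) ->
     exists U, rows_in K (Z - D j *m U)).
Proof.
have [_ _ eK] := hN; have hK := presents_submodule hN.
have eB u v : eN (u - v) = 0 <-> eN u = eN v.
  have [eP _ _] := hN.
  rewrite -scaleN1r addrC eP rmorphN1 scaleN1r addrC; split=> [/eqP|->].
    by rewrite subr_eq0 => /eqP.
  by rewrite subrr.
split=> [van Z hZ|van g gc].
  have [|u uE] := van (mx_map eN Z).
    move=> x; have [x' ->] := qpi_mx_surj x; rewrite /= -qpi_mxM (mx_mapE hN) -mulmxA.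
    by apply/eK; apply: hZ.
  have [U UE] := mx_map_surj hN u.
  exists U => y; apply/eK; rewrite mulmxBr; apply/eB.
  by rewrite -(mx_mapE hN) uE UE /= -qpi_mxM (mx_mapE hN) mulmxA.
have [Z ZE] := mx_map_surj hN g.
have [|U hU] := van Z.
  move=> y; apply/eK; rewrite mulmxA -(mx_mapE hN) -ZE qpi_mxM.
  exact: gc.
exists (mx_map eN U) => x; have [x' ->] := qpi_mx_surj x.
rewrite ZE /= -qpi_mxM !(mx_mapE hN) -mulmxA; apply/eB; rewrite -mulmxBr.
by apply/eK; apply: hU.
Qed.

(** By independence of the resolution, the vanishing of [Ext] is a statement on
    matrices. *)
Lemma Ext_vanishingP j : ~ Ext_neq0 M N j.+1 <->
  (forall Z : 'M[Q]_(b j.+1, l), rows_in K (D j.+1 *m Z) ->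
     exists U, rows_in K (Z - D j *m U)).
Proof.
rewrite -mx_vanishingP; split=> [nE g gc|van [P [g [gc ngc]]]].
  by apply: contrapT => ngc; apply: nE; exists mx_resolution, g.
exact/ngc/(cohomology_vanishing_transfer van).
Qed.

End Resolution.

End Presentation.

Local Open Scope classical_set_scope.

(** * Dependence of Ext on the hypersurface *)

Definition Ext_bounded (A : comNzRingType) (M N : lmodType A) : Prop :=
  exists i0, forall i, (i0 <= i)%N -> ~ Ext_neq0 M N i.

Lemma Ext_infiniteP (A : comNzRingType) (M N : lmodType A) :
  infinite_set [set i | Ext_neq0 M N i] <-> ~ Ext_bounded M N.
Proof.
split=> [inf [i0 h]|nb /finite_seqP[s sE]].
  apply: inf; apply: (sub_finite_set _ (finite_II i0)) => i /= Ei.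
  by rewrite ltnNge; apply/negP => /h.
apply: nb; exists (\max_(i <- s) i).+1 => i si Ei.
have : [set` s] i by rewrite -sE.
by move=> /= /(leq_bigmax_seq (P := xpredT) (F := id)) /(_ isT); rewrite leqNgt si.
Qed.

Lemma presents_restrict (Q : comNzRingType) (a c : idealr Q) (sac : {subset a <= c})
    (M : lmodType {ideal_quot c}) m (L : 'rV[Q]_m -> Prop) (e : 'rV[Q]_m -> M) :
  presents L e -> presents L (e : _ -> restrict_scalars M (quot_map sac)).
Proof.
move=> [eP eS eK]; split=> // x u v; rewrite eP; congr (_ + _).
by rewrite -(quot_mapE sac).
Qed.

Section Family.
Variables (Q : comNzRingType) (n : idealr Q).
Hypothesis hn : local_ring n.
Hypothesis noethQ : forall m, noetherian_rows Q m.

(** A single matrix resolution over [Q[t]] specializes to resolutions at both [c0] and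
    [c1], which turns both sides into statements on its cohomology. The bound grows
    by one because only positive degrees are expressed by matrices. *)
Lemma Ext_bounded_family (F : {poly Q}) (c0 c1 : Q) (a0 a1 : idealr Q)
    (M0 N0 : lmodType {ideal_quot a0}) (M1 N1 : lmodType {ideal_quot a1})
    m (L : 'rV[Q]_m -> Prop) (eM0 : 'rV[Q]_m -> M0) (eM1 : 'rV[Q]_m -> M1)
    l (K : 'rV[Q]_l -> Prop) (eN0 : 'rV[Q]_l -> N0) (eN1 : 'rV[Q]_l -> N1) :
  c0 - c1 \in n ->
  (forall y, y * F.[c0] = 0 -> y = 0) -> (forall y, y * F.[c1] = 0 -> y = 0) ->
  (forall x, x \in a0 <-> exists y, x = F.[c0] * y) ->
  (forall x, x \in a1 <-> exists y, x = F.[c1] * y) ->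
  (forall k u, L (F`_k *: u)) -> (forall k u, K (F`_k *: u)) ->
  presents L eM0 -> presents L eM1 -> presents K eN0 -> presents K eN1 ->
  Ext_bounded M0 N0 -> Ext_bounded M1 N1.
Proof.
move=> c01 reg0 reg1 a0P a1P LF KF hM0 hM1 hN0 hN1 [i0 hi0].
have noethS := noetherian_rowsW (hilbert_basis noethQ).
have hL := presents_submodule hM0; have hK := presents_submodule hN0.
have [r [D0 D0P]] := noethS _ _ (submodule_poly_rows hL).
pose b := res_rank F noethS D0; pose D i := res_mx F noethS D0 i.
have DSP i x : syzygy F (D i) x <-> exists y, x = y *m D i.+1 by exact: res_mxP.
have evP c (reg : forall y, y * F.[c] = 0 -> y = 0) :=
  @ev_rel_rowsP Q b D F L hL LF D0P DSP c reg.
have E0 j := @Ext_vanishingP Q a0 F.[c0] a0P b (fun i => ev_mx c0 (D i)) M0 L eM0 hM0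
  (evP c0 reg0 0%N) (fun i => evP c0 reg0 i.+1) N0 l K eN0 hN0 j.
have E1 j := @Ext_vanishingP Q a1 F.[c1] a1P b (fun i => ev_mx c1 (D i)) M1 L eM1 hM1
  (evP c1 reg1 0%N) (fun i => evP c1 reg1 i.+1) N1 l K eN1 hN1 j.
exists i0.+1 => -[//|j] ij; apply/E1.
apply: (vanishing_specialization DSP hK KF noethS hn c01 (j0 := i0)) => // k ik.
exact/E0/hi0/leqW.
Qed.

Variable I : idealr Q.

Definition in_nI (f : Q) : Prop := exists r : seq (Q * Q),
  (forall p, p \in r -> p.1 \in n /\ p.2 \in I) /\ f = \sum_(p <- r) p.1 * p.2.

Lemma in_nI_subr f x y : x \in n -> y \in I -> in_nI (f + x * y) -> in_nI f.
Proof.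
move=> xn yI [r [rP fE]]; exists ((- x, y) :: r); split.
  by move=> p; rewrite inE => /predU1P[->|/rP//]; rewrite rpredN.
by rewrite big_cons -fE mulNr addrC addrK.
Qed.

Hypothesis regI : forall f, f \in I -> ~ in_nI f -> forall y, y * f = 0 -> y = 0.

Variables (M N : lmodType {ideal_quot I}).
Variables (m : nat) (L : 'rV[Q]_m -> Prop) (eM : 'rV[Q]_m -> M) (hM : presents L eM).
Variables (l : nat) (K : 'rV[Q]_l -> Prop) (eN : 'rV[Q]_l -> N) (hN : presents K eN).

Lemma presents_kill m' (M' : lmodType {ideal_quot I}) (L' : 'rV[Q]_m' -> Prop) e x u :
  presents (M := M') L' e -> x \in I -> L' (x *: u).
Proof.
move=> he xI; have [eP _ eK] := he; apply/eK.
have e0 : e 0 = 0 by apply/eK; exact: (presents_submodule he).1.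
rewrite -[_ *: _]addr0 eP e0 addr0 (_ : qpi I x = 0) ?scale0r //.
by rewrite -(rmorph0 (qpi I)); apply/qpi_eq; rewrite subr0.
Qed.

Lemma princP (J : idealr Q) (f : ideal_mod J) x :
  x \in (@princ Q J f : idealr Q) <-> exists y, x = ideal_val f * y.
Proof.
split=> [/asboolP[y ->]|[y ->]]; first by exists (y ord0); rewrite big_ord1 mulrC.
by apply/asboolP; exists (fun=> y); rewrite big_ord1 mulrC.
Qed.

(** Adding to [f] one term [x * y], with [x] in [n] and [y] in [I], moves the
    parameter from [0] to [x] in the family [f + y 'X]. *)
Lemma Ext_bounded_perturb (r : seq (Q * Q)) (f g : Q) (af ag : idealr Q)
    (Mf Nf : lmodType {ideal_quot af}) (Mg Ng : lmodType {ideal_quot ag})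
    (eMf : 'rV[Q]_m -> Mf) (eNf : 'rV[Q]_l -> Nf)
    (eMg : 'rV[Q]_m -> Mg) (eNg : 'rV[Q]_l -> Ng) :
  f \in I -> ~ in_nI f ->
  (forall p, p \in r -> p.1 \in n /\ p.2 \in I) -> g = f + \sum_(p <- r) p.1 * p.2 ->
  (forall x, x \in af <-> exists y, x = f * y) ->
  (forall x, x \in ag <-> exists y, x = g * y) ->
  presents L eMf -> presents K eNf -> presents L eMg -> presents K eNg ->
  Ext_bounded Mf Nf -> Ext_bounded Mg Ng.
Proof.
elim: r => [|[x y] r IH] in f af Mf Nf eMf eNf *.
  move=> fI fn _; rewrite big_nil addr0 => -> afP agP hMf hNf hMg hNg.
  have kI k : (f%:P)`_k \in I by rewrite coefC; case: eqP => // _; apply: rpred0.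
  apply: (Ext_bounded_family (F := f%:P) (c0 := 0) (c1 := 0) _ _ _ _ _ _ _ hMf hMg hNf hNg);
    rewrite ?hornerC //.
  - by rewrite subrr rpred0.
  - exact: regI.
  - exact: regI.
  - by move=> k u; apply: presents_kill hM _.
  - by move=> k u; apply: presents_kill hN _.
move=> fI fn rP gE afP agP hMf hNf hMg hNg.
have [xn yI] : x \in n /\ y \in I by apply: (rP (x, y)); rewrite mem_head.
have f'I : f + x * y \in I by apply: rpredD => //; apply: idealMr.
have f'n : ~ in_nI (f + x * y) by move/(in_nI_subr xn yI).
pose f' : ideal_mod I := IdealMod (f'I : ideal_pred I (f + x * y)).
pose F := f%:P + y%:P * 'X : {poly Q}.
have kI k : F`_k \in I.
  rewrite coefD coefC coefMX coefC; apply: rpredD.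
    by case: eqP => // _; apply: rpred0.
  by case: eqP => _; [|case: eqP => // _]; apply: rpred0.
have F0 : F.[0] = f by rewrite !hornerE ?mulr0 ?addr0.
have Fx : F.[x] = f + x * y by rewrite !hornerE [y * x]mulrC.
have hM' := presents_restrict (@princ_sub Q I f') hM.
have hN' := presents_restrict (@princ_sub Q I f') hN.
move=> bf; apply: (IH (f + x * y) _ _ _ _ _ f'I f'n _ _ (princP f') agP hM' hN' hMg hNg).
- by move=> p pr; apply: rP; rewrite inE pr orbT.
- by rewrite gE big_cons addrA.
apply: (Ext_bounded_family (F := F) (c0 := 0) (c1 := x) _ _ _ _ _ _ _ hMf hM' hNf hN' bf);
  rewrite ?F0 ?Fx //.
- by rewrite sub0r rpredN.
- exact: regI.
- exact: regI.
- exact: princP.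
- by move=> k u; apply: presents_kill hM _.
- by move=> k u; apply: presents_kill hN _.
Qed.

End Family.

Lemma fin_gen_presents (Q : comNzRingType) (I : idealr Q) (M : lmodType {ideal_quot I}) :
  fin_gen M -> exists m (L : 'rV[Q]_m -> Prop) (e : 'rV[Q]_m -> M), presents L e.
Proof.
move=> [s sP]; pose e (v : 'rV[Q]_(size s)) : M := \sum_i qpi I (v 0 i) *: s`_i.
exists (size s), (fun v => e v = 0), e; split=> // [c u v|y].
  rewrite /e scaler_sumr -big_split /=; apply: eq_bigr => i _.
  by rewrite !mxE rmorphD rmorphM scalerDl scalerA.
have /asboolP[a ->] := sP y; exists (\row_i repr (a i)).
by apply: eq_bigr => i _; rewrite mxE qpi_repr.
Qed.

Lemma red0 (Q : comNzRingType) (a : idealr Q) (M : lmodType Q) : red a (0 : M) = 0.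
Proof. by apply: (addIr (red a (0 : M))); rewrite -redD !add0r. Qed.

(** Equality in [I / n I], with the products taken in [Q] instead of the module [I]. *)
Lemma red_eq_in_nI (Q : comNzRingType) (n I : idealr Q) (f g : ideal_mod I) :
  red n f = red n g <-> in_nI n I (ideal_val f - ideal_val g : Q).
Proof.
rewrite redE; split=> [/asboolP[r [rP rE]]|[r [rP rE]]].
  exists [seq (p.1, ideal_val p.2 : Q) | p <- r]; split.
    move=> _ /mapP[p pr ->] /=; split; last exact: ideal_modP.
    by have /allP/(_ p pr)/andP[] := rP.
  have := congr1 (fun h : ideal_mod I => \val h) rE; rewrite raddfB raddf_sum /= => ->.
  by rewrite big_map; apply: eq_bigr.
apply/asboolP.
have : exists t : seq (Q * ideal_mod I), [seq (p.1, ideal_val p.2 : Q) | p <- t] = r /\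
    all (fun p => p.1 \in n) t.
  elim: r rP {rE} => [|[x y] r IH] rP; first by exists [::].
  have [t [tr tn]] : exists t : seq (Q * ideal_mod I),
      [seq (p.1, ideal_val p.2 : Q) | p <- t] = r /\ all (fun p => p.1 \in n) t.
    by apply: IH => p pr; apply: rP; rewrite inE pr orbT.
  have [xn yI] : x \in n /\ y \in I by apply: (rP (x, y)); rewrite mem_head.
  exists ((x, IdealMod (yI : ideal_pred I y)) :: t); split; first by rewrite /= tr.
  by rewrite /= xn.
move=> [t [tr tn]]; exists t; split.
  by apply: sub_all tn => p /= ->.
apply: val_inj; rewrite raddfB raddf_sum /= rE -tr big_map.
by apply: eq_bigr.
Qed.

Section Inclusion.
Variables (Q : comNzRingType) (n : idealr Q) (hQ : regular_local_ring n).
Variables (I : idealr Q) (c : nat) (s : c.-tuple Q^o).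
Hypotheses (hs : regular_sequence s) (hI : I =i submod_span s).
Variables (M N : lmodType {ideal_quot I}) (hM : fin_gen M) (hN : fin_gen N).

Lemma generator_regular f : f \in I -> ~ in_nI n I f -> forall y, y * f = 0 -> y = 0.
Proof.
move=> fI fn; have [noeQ hn _] := hQ.
have sI i : (i < size s)%N -> s`_i \in I.
  move=> si; rewrite hI; apply/submod_spanP; exists (fun k => (k == i)%:R).
  rewrite (bigD1 (Ordinal si)) //= eqxx mul1r big1 ?addr0 // => k.
  by rewrite -val_eqE /= => /negPf ->; rewrite mul0r.
apply: (minimal_generator_regular hn (noetherian_rows1 noeQ) hs).
- by move=> x /(nthP 0)[i si <-]; apply: (local_ideal_sub hn (a := I)); apply: sI.
- by rewrite -hI.
move=> a an fE; apply: fn; exists [seq (a i, s`_i : Q) | i <- iota 0 (size s)]; split.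
  move=> p /mapP[i]; rewrite mem_iota => /andP[_ si] ->.
  by split; [apply: an | apply: sI].
by rewrite fE big_map -[X in iota 0 X]subn0 big_mkord.
Qed.

Lemma support_variety_sub (J J' : idealr Q) (sJI : {subset J <= I})
    (sJ'I : {subset J' <= I}) :
  range (phi n sJI) `<=` range (phi n sJ'I) ->
  phi n sJI @` support_variety n (restrict_scalars M (quot_map sJI))
                                 (restrict_scalars N (quot_map sJI)) `<=`
  phi n sJ'I @` support_variety n (restrict_scalars M (quot_map sJ'I))
                                  (restrict_scalars N (quot_map sJ'I)).
Proof.
move=> sub _ [v vV <-]; have [noeQ hn _] := hQ.
have [pv0|pv0] := pselect (phi n sJI v = 0).
  exists 0; first by left.
  by rewrite pv0 -[X in phi _ _ X](red0 n) phiE -[RHS](red0 n); congr red; apply: val_inj.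
case: vV => [v0|[f [vE infE]]].
  by case: pv0; rewrite v0 -(red0 n) phiE -[RHS](red0 n); congr red; apply: val_inj.
have [v' _ v'E] : range (phi n sJ'I) (phi n sJI v) by apply: sub; exists v.
pose g := repr v'; have v'g : v' = red n g by rewrite /g red_repr.
have fg : red n (ideal_incl sJ'I g) = red n (ideal_incl sJI f).
  by rewrite -!phiE -v'g -vE.
have fn : ~ in_nI n I (ideal_val f : Q).
  move=> fn; apply: pv0; rewrite vE phiE -(red0 n); apply/red_eq_in_nI.
  by rewrite subr0.
exists v' => //; right; exists g; split=> //.
apply/Ext_infiniteP => bg; move/Ext_infiniteP: infE; apply.
have [r [rP rE]] := (red_eq_in_nI _ _ _).1 (esym fg).
have [m [L [eM pM]]] := fin_gen_presents hM.
have [l [K [eN pN]]] := fin_gen_presents hN.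
have gn : ~ in_nI n I (ideal_val g : Q).
  move=> gn; apply: pv0; rewrite vE phiE -fg -(red0 n); apply/red_eq_in_nI.
  by rewrite subr0.
apply: (Ext_bounded_perturb hn (noetherian_rowsW (noetherian_rows1 noeQ))
  generator_regular pM pN _ gn rP _ (princP g) (princP f)
  (presents_restrict _ (presents_restrict _ pM))
  (presents_restrict _ (presents_restrict _ pN))
  (presents_restrict _ (presents_restrict _ pM))
  (presents_restrict _ (presents_restrict _ pN)) bg).
  exact/sJ'I/ideal_modP.
by rewrite -rE addrC subrK.
Qed.

End Inclusion.

Theorem proposition3p2 (Q : comNzRingType) (n : idealr Q)
  (hQ : regular_local_ring n)
  (hk : GRing.closed_field_axiom {ideal_quot n})
  (I : idealr Q) (hIn2 : {subset I <= prodS (n : {pred Q}) (n : {pred Q^o})})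
  (c : nat) (s : c.-tuple Q^o) (hs : regular_sequence s)
  (hI : I =i submod_span s)
  (J J' : idealr Q) (sJI : {subset J <= I}) (sJ'I : {subset J' <= I})
  (hJ : intermediate n I J) (hJ' : intermediate n I J')
  (heq : range (phi n sJI) = range (phi n sJ'I))
  (M N : lmodType {ideal_quot I}) (hM : fin_gen M) (hN : fin_gen N) :
  phi n sJI @` support_variety n (restrict_scalars M (quot_map sJI))
                                 (restrict_scalars N (quot_map sJI)) =
  phi n sJ'I @` support_variety n (restrict_scalars M (quot_map sJ'I))
                                  (restrict_scalars N (quot_map sJ'I)).
Proof.
apply/seteqP; split.
  by apply: (support_variety_sub hQ hs hI hM hN); rewrite heq.
by apply: (support_variety_sub hQ hs hI hM hN); rewrite heq.
Qed.
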